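(* For every positive integer $n$, the Möbius homology associated with $V_n=\mathbb{Z}[\frac1{3n}][x,y]/(x^n,y^3-xy)$ is strictly more powerful, as an invariant of perfect matching graphs, than the $n$-bracket $\langle\cdot\rangle_n$. That is: the graded Poincaré polynomial $Mh_n(\Gamma_M)$ determines $\langle\Gamma_M\rangle_n$ (by setting $t=-1$), and there exist perfect matching graphs $\Gamma_M$ and $\Gamma'_{M'}$ with trivalent underlying graphs such that $\langle\Gamma_M\rangle_n=\langle\Gamma'_{M'}\rangle_n$ but $Mh_n(\Gamma_M)\ne Mh_n(\Gamma'_{M'})$.
   Context: **Ribbon graphs.** Graphs are finite undirected multigraphs, connected with nonempty edge set. An (oriented) ribbon graph is a graph $G$ embedded in an oriented compact surface with boundary that deformation retracts onto $G$; equivalently, $G$ with a cyclic order of the half-edges at each vertex. It is represented by a ribbon diagram: a drawing of $G$ in the plane with vertices as dots and edges as curves that may cross, inducing the given cyclic orders counterclockwise. A perfect matching graph $\Gamma_M$ is a ribbon graph with a perfect matching $M=\{e_1,\dots,e_\ell\}$ of its underlying graph (each vertex is incident to exactly one edge of $M$). **Smoothings, states, $n$-bracket.** Draw a matching edge $e$ of a trivalent perfect matching graph vertically, with the two other half-edges at its top vertex going up-left and up-right, and the two other half-edges at its bottom vertex going down-left and down-right. The 0-smoothing deletes $e$ and its endpoints and joins up-left with down-left and up-right with down-right; the 1-smoothing joins up-left with down-right and up-right with down-left. The $n$-bracket is determined by $\langle\Gamma_M\rangle_n=\langle\text{0-smoothing at }e\rangle_n-\langle\text{1-smoothing at }e\rangle_n$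 for every matching edge $e$, multiplicativity under disjoint union, and $$\langle\text{circle}\rangle_n=\begin{cases}2(2+2q^2+\dots+2q^{n-2}+qb+q^3b+\dots+q^{n-1}b)&n\text{ even},\\3(1+q+\dots+q^{n-1})&n\text{ odd},\end{cases}$$ where $q^n=1$ and (for $n$ even) $b^2=1$. For $\alpha\in\{0,1\}^\ell$, the state $\Gamma_\alpha$ is the collection of circles obtained by applying the $\alpha_i$-smoothing at each $e_i$; $k_\alpha$ is its number of circles, $|\alpha|=\sum\alpha_i$. **Möbius homology.** Let $R=\mathbb{Z}[\frac1{3n}]$, $V=V_n$ with basis $x^iy^j$ ($0\le i\le n-1$, $0\le j\le2$), graded by $\mathcal{G}=\mathbb{Z}/n\mathbb{Z}\times\mathbb{Z}/2\mathbb{Z}$ with $x^iy^j$ in degree $(2i+j,j)$ for $n$ even, and by $\mathcal{G}=\mathbb{Z}/n\mathbb{Z}$ with $x^iy^j$ in degree $2i+j$ for $n$ odd. Let $\mu_V$ be multiplication, $m_V(v)=v\cdot x^{(n-2)/2}y^2$ for $n$ even, $m_V(v)=v\cdot x^{(n-1)/2}y$ for $n$ odd, and $$\Delta_V(v)=-\tfrac1{3n}\sum_{i+j=n,\ i,j>0}(vx^i)\otimes x^j+\tfrac1{3n}\sum_{i+j=n-1}\big((vx^iy^2)\otimes x^j+(vx^iy)\otimes x^jy+(vx^i)\otimes x^jy^2\big).$$ Put $C^{i}(\Gamma_M)=\bigoplus_{|\alpha|=i}V^{\otimes k_\alpha}$, with tensor factors indexed by the circles of $\Gamma_\alpha$.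 If $\alpha'$ arises from $\alpha$ by changing one entry 0 to 1, $\partial_{\alpha\alpha'}$ is $\mu_V$ if two circles merge, $\Delta_V$ if one circle splits into two, $m_V$ if one circle is changed into one circle, on the affected factors, and the identity on the others. The differential is $\partial^i(v)=\sum_{\alpha'}(-1)^{f_{\alpha\alpha'}}\partial_{\alpha\alpha'}(v)$ for $v\in V^{\otimes k_\alpha}$, where $f_{\alpha\alpha'}$ is the number of entries 1 to the left of the changed entry; it preserves the $\mathcal{G}$-grading. The homology is the Möbius homology $MH_n^{i,g}(\Gamma_M;R)$, and $Mh_n(\Gamma_M)=\sum_it^i\,q\mathrm{dim}\,MH_n^{i,*}(\Gamma_M;R)$, where $q\mathrm{dim}$ sums ranks of graded pieces times $q^ab^\epsilon$ in degree $(a,\epsilon)$ ($n$ even), or times $q^a$ in degree $a$ ($n$ odd). *)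

(* Defs.v *)
From HB Require Import structures.
From mathcomp Require Import all_boot all_order all_fingroup all_algebra.
From mathcomp Require Import boolp.

Set Implicit Arguments.
Unset Strict Implicit.
Unset Printing Implicit Defensive.

Import GRing.Theory.
Local Open Scope ring_scope.

(** * Perfect matching graphs *)

(* A connected ribbon graph on its half-edges: the orbits of [rot] are the
   vertices, [rot] being the counterclockwise successor, and the pairs
   {h, opp h} are the edges.  Every vertex carries a half-edge because the
   graph is connected with nonempty edge set. *)
Record ribbon := Ribbon {
  half : finType;
  rot : {perm half};
  opp : half -> half;
  oppK : involutive opp;
  opp_neq : forall h, opp h != h;
  half_gt0 : (0 < #|half|)%N;
  ribbon_connected : forall h k : half,
    connect (fun a b => (b == rot a) || (b == opp a)) h k
}.
Arguments rot {r}.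
Arguments opp {r}.

Definition on_edge (G : ribbon) (e h : half G) := (h == e) || (h == opp e).

(* The matching {e_0, ..., e_(l-1)} is listed in a chosen order, and [medge i]
   is one of the two half-edges of e_i; exchanging it with [opp (medge i)]
   rotates the local picture below by a half-turn and changes neither the
   smoothings nor the maps attached to them.  Since exactly one half-edge at
   each vertex is matched, no matching edge is a loop. *)
Record pmgraph := PMGraph {
  pm_ribbon :> ribbon;
  ell : nat;
  medge : 'I_ell -> half pm_ribbon;
  medge_inj : forall i j, on_edge (medge i) (medge j) -> i = j;
  medge_perfect : forall h : half pm_ribbon,
    #|[set k in porbit rot h | [exists i, on_edge (medge i) k]]| = 1%N
}.
Arguments medge {p}.

Definition trivalent (G : ribbon) := forall h : half G, #|porbit rot h| = 3%N.

Record tpmgraph := TPMGraph {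
  tpm_pmgraph :> pmgraph;
  tpm_trivalent : trivalent tpm_pmgraph
}.

Section Smoothings.
Variable G : tpmgraph.

Definition matched : {set half G} := [set h | [exists i, on_edge (medge i) h]].

Lemma rot_neq (h : half G) : (rot h != h) && (rot (rot h) != h).
Proof.
have := uniq_traject_porbit rot h; rewrite tpm_trivalent /= !inE !negb_or andbT.
by case/andP => /andP [+ +] _; rewrite ![h == _]eq_sym => -> ->.
Qed.

Lemma matched_uniq (h k : half G) :
  h \in matched -> k \in porbit rot h -> k \in matched -> k = h.
Proof.
rewrite !inE => mh kh mk; have /eqP/cards1P [x e] := medge_perfect h.
have: h \in [set x] by rewrite -e inE porbit_id.
have: k \in [set x] by rewrite -e inE kh.
by rewrite !inE => /eqP -> /eqP ->.
Qed.

Lemma rot_unmatched (h : half G) : h \in matched -> rot h \notin matched.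
Proof.
move=> mh; apply/negP => /(matched_uniq mh); have := mem_porbit rot 1 h.
by rewrite permX => /= -> /(_ isT) e; have := rot_neq h; rewrite e eqxx.
Qed.

Lemma rot2_unmatched (h : half G) :
  h \in matched -> rot (rot h) \notin matched.
Proof.
move=> mh; apply/negP => /(matched_uniq mh); have := mem_porbit rot 2 h.
by rewrite permX => /= -> /(_ isT) e; have := rot_neq h; rewrite e eqxx andbF.
Qed.

Lemma medge_matched (i : 'I_(ell G)) : medge i \in matched.
Proof. by rewrite inE; apply/existsP; exists i; rewrite /on_edge eqxx. Qed.

Lemma opp_medge_matched (i : 'I_(ell G)) : opp (medge i) \in matched.
Proof.
by rewrite inE; apply/existsP; exists i; rewrite /on_edge eqxx orbT.
Qed.

Definition strand_half := {h : half G | h \notin matched}.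

(* Draw e_i vertically with [medge i] at its top vertex.  Counterclockwise from
   e_i one meets up-right, up-left at the top vertex, and down-left, down-right
   at the bottom one. *)
Definition UR (i : 'I_(ell G)) : strand_half :=
  exist _ (rot (medge i)) (rot_unmatched (medge_matched i)).
Definition UL (i : 'I_(ell G)) : strand_half :=
  exist _ (rot (rot (medge i))) (rot2_unmatched (medge_matched i)).
Definition DL (i : 'I_(ell G)) : strand_half :=
  exist _ (rot (opp (medge i))) (rot_unmatched (opp_medge_matched i)).
Definition DR (i : 'I_(ell G)) : strand_half :=
  exist _ (rot (rot (opp (medge i)))) (rot2_unmatched (opp_medge_matched i)).

Definition state := {ffun 'I_(ell G) -> bool}.

Definition set_state (al : state) (i : 'I_(ell G)) (b : bool) : state :=
  [ffun j => if j == i then b else al j].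

Definition weight (al : state) : nat := (\sum_i al i)%N.

Definition joined (al : state) (x y : strand_half) :=
  [exists i, if al i then (x == UL i) && (y == DR i)
                          || (x == UR i) && (y == DL i)
             else (x == UL i) && (y == DL i) || (x == UR i) && (y == DR i)].

Definition strand (al : state) (x y : strand_half) :=
  [|| val y == opp (val x), joined al x y | joined al y x].

(* A circle of a state is recorded as the set of half-edges it runs through, so
   a circle which is not affected by a change of smoothing is the same set in
   both states. *)
Definition circle_set (al : state) (x : strand_half) : {set strand_half} :=
  [set y | connect (strand al) x y].

Definition circles (al : state) : {set {set strand_half}} :=
  [set circle_set al x | x : strand_half].

Definition circle (al : state) := {c : {set strand_half} | c \in circles al}.

Lemma circle_set_in (al : state) (x : strand_half) :
  circle_set al x \in circles al.
Proof. exact: imset_f. Qed.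

Definition circle_at (al : state) (x : strand_half) : circle al :=
  exist _ (circle_set al x) (circle_set_in al x).

End Smoothings.
Arguments UR {G}.
Arguments UL {G}.
Arguments DL {G}.
Arguments DR {G}.

(** * The n-bracket *)

(* The grading group is Z/n x Z/(gpar n): its second factor is Z/2 for n even
   and trivial for n odd.  The ring Z[q, b]/(q^n - 1, b^(gpar n) - 1) is thus
   Z[q]/(q^n - 1) for n odd. *)
Definition gpar (n : nat) : nat := if odd n then 1%N else 2%N.

Definition Zq (n : nat) := {poly %/ ('X^n - 1 : {poly int})}.
HB.instance Definition _ n := GRing.ComNzRing.on (Zq n).

Definition Zqb (n : nat) := {poly %/ ('X^(gpar n) - 1 : {poly Zq n})}.
HB.instance Definition _ n := GRing.ComNzRing.on (Zqb n).

Definition qvar (n : nat) : Zqb n := qpolyC _ ('qX : Zq n).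
Definition bvar (n : nat) : Zqb n := 'qX.

Definition circle_value (n : nat) : Zqb n :=
  if odd n then 3 * \sum_(k < n) qvar n ^+ k
  else 2 * (\sum_(k < n./2) 2 * qvar n ^+ k.*2
            + \sum_(k < n./2) qvar n ^+ k.*2.+1 * bvar n).

(* Bracket of the diagram in which the edges of [s] are still present and the
   other matching edges are smoothed according to [al]. *)
Fixpoint skein (n : nat) (G : tpmgraph) (s : seq 'I_(ell G)) (al : state G) :
    Zqb n :=
  if s is i :: s' then
    skein n s' (set_state al i false) - skein n s' (set_state al i true)
  else circle_value n ^+ #|circles al|.

Definition bracket (n : nat) (G : tpmgraph) : Zqb n :=
  skein n (enum 'I_(ell G)) [ffun=> false].

Lemma set_stateC (G : tpmgraph) (al : state G) i j b c : i != j ->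
  set_state (set_state al i b) j c = set_state (set_state al j c) i b.
Proof.
move=> ij; apply/ffunP => k; rewrite !ffunE.
by case: (eqVneq k j) => // ->; rewrite eq_sym (negbTE ij).
Qed.

(* The skein relation holds at every edge, whatever the order of resolution. *)
Lemma skeinE (n : nat) (G : tpmgraph) (s : seq 'I_(ell G)) (al : state G) i :
  i \in s -> skein n s al =
  skein n (rem i s) (set_state al i false)
  - skein n (rem i s) (set_state al i true).
Proof.
elim: s al => //= j s IH al; rewrite inE eq_sym; case: (eqVneq j i) => [-> //|ji].
move=> /= si /=; rewrite !(IH _ si) !(set_stateC _ _ _ ji) !opprD !opprK !addrA.
by congr (_ + _); rewrite -!addrA; congr (_ + _); rewrite addrC.
Qed.

(** * The ring R = Z[1/(3n)] and the algebra V = R[x, y]/(x^n, y^3 - xy) *)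

Definition Zinv_pred (n : nat) : {pred rat} :=
  [pred r | `[< exists (a : int) (k : nat), r = a%:~R / (3 * n)%:R ^+ k >]].

Lemma Zinv_subring n : subring_closed (Zinv_pred n).
Proof.
have inv0 (k : nat) : ((3 * n)%:R : rat) = 0 -> 
    exists c : int, ((3 * n)%:R ^+ k : rat)^-1 = c%:~R.
  move=> ->; case: k => [|k]; first by exists 1; rewrite expr0 invr1.
  by exists 0; rewrite expr0n invr0.
have pwI (k : nat) : ((3 * n)%:R ^+ k : rat) = ((3 * n)%:Z ^+ k)%:~R.
  by rewrite rmorphXn /= pmulrn.
split.
- by apply/asboolP; exists 1, 0%N; rewrite expr0 divr1.
- move=> _ _ /asboolP [a [k ->]] /asboolP [c [l ->]]; apply/asboolP.
  have [N0|N0] := eqVneq ((3 * n)%:R : rat) 0.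
    have [u ->] := inv0 k N0; have [v ->] := inv0 l N0.
    by exists (a * u - c * v), 0%N; rewrite expr0 divr1 rmorphB /= !rmorphM.
  exists (a * (3 * n)%:Z ^+ l - c * (3 * n)%:Z ^+ k), (k + l)%N.
  rewrite rmorphB /= !rmorphM /= -!pwI exprD mulrBl.
  by congr (_ - _); rewrite invfM ?(mulrC (_ ^- k)) mulrA ?mulfK ?expf_neq0 //;
     rewrite mulrAC mulfK ?expf_neq0.
- move=> _ _ /asboolP [a [k ->]] /asboolP [c [l ->]]; apply/asboolP.
  by exists (a * c), (k + l)%N; rewrite rmorphM /= exprD invfM mulrACA.
Qed.

HB.instance Definition _ n :=
  GRing.isSubringClosed.Build rat (Zinv_pred n) (Zinv_subring n).

Record Zinv (n : nat) := MkZinv {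
  Zinv_val :> rat;
  _ : Zinv_val \in Zinv_pred n
}.
HB.instance Definition _ n := [isSub for @Zinv_val n].
HB.instance Definition _ n := [Choice of Zinv n by <:].
HB.instance Definition _ n := [SubChoice_isSubComNzRing of Zinv n by <:].

Lemma inv3n_proof n : ((3 * n)%:R : rat)^-1 \in Zinv_pred n.
Proof. by apply/asboolP; exists 1, 1%N; rewrite expr1 mul1r. Qed.

Definition inv3n (n : nat) : Zinv n := MkZinv (inv3n_proof n).

Definition Vx (n : nat) := {poly %/ ('X^n : {poly Zinv n})}.
HB.instance Definition _ n := GRing.ComNzRing.on (Vx n).

Definition V (n : nat) :=
  {poly %/ ('X^3 - ('qX : Vx n)%:P * 'X : {poly Vx n})}.
HB.instance Definition _ n := GRing.ComNzRing.on (V n).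

Definition xV (n : nat) : V n := qpolyC _ ('qX : Vx n).
Definition yV (n : nat) : V n := 'qX.

(* (i, j) stands for the basis element x^i y^j *)
Definition mono (n : nat) : finType := ('I_n * 'I_3)%type.

Definition monoV (n : nat) (p : mono n) : V n := xV n ^+ p.1 * yV n ^+ p.2.

(* the coefficient of x^i y^j in v: elements of V are represented by their
   remainders, of degree < 3 in y and < n in x *)
Definition coefV (n : nat) (v : V n) (p : mono n) : Zinv n :=
  ((v : {poly Vx n})`_p.2 : {poly Zinv n})`_p.1.

Definition mV (n : nat) (v : V n) : V n :=
  if odd n then v * (xV n ^+ n.-1./2 * yV n)
  else v * (xV n ^+ (n - 2)./2 * yV n ^+ 2).

(* V (x) V in the basis x^i y^j (x) x^k y^l *)
Definition tensV (n : nat) (v w : V n) : {ffun mono n * mono n -> (Zinv n)^o} :=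
  [ffun p => coefV v p.1 * coefV w p.2].

Definition DeltaV (n : nat) (v : V n) : {ffun mono n * mono n -> (Zinv n)^o} :=
  let x := xV n in let y := yV n in
  - (inv3n n *: \sum_(1 <= i < n) tensV (v * x ^+ i) (x ^+ (n - i)))
  + inv3n n *: \sum_(0 <= i < n)
      (tensV (v * x ^+ i * y ^+ 2) (x ^+ (n.-1 - i))
       + tensV (v * x ^+ i * y) (x ^+ (n.-1 - i) * y)
       + tensV (v * x ^+ i) (x ^+ (n.-1 - i) * y ^+ 2)).

(** * Moebius homology *)

Section Homology.
Variables (n : nat) (G : tpmgraph).

(* A generator (al, f) of the chain module is a state with a basis element of V
   on each of its circles, i.e. a basis element of V^{(x) k_al}. *)
Definition gen : finType :=
  {al : state G & {ffun circle al -> mono n}}.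

Definition chain := {ffun gen -> (Zinv n)^o}.

(* For al' obtained from al by changing entry i from 0 to 1: the coefficient of
   the generator s' on al' in the image of the generator s on al under the map
   attached to that change.  The affected circles are those through UL i or
   UR i; there are two of them iff these half-edges lie on distinct circles,
   and this never happens both before and after the change. *)
Definition edge_coef (i : 'I_(ell G)) (s s' : gen) : Zinv n :=
  let al := tag s in let f := tagged s in
  let al' := tag s' in let f' := tagged s' in
  let cL := circle_at al (UL i) in let cR := circle_at al (UR i) in
  let cL' := circle_at al' (UL i) in let cR' := circle_at al' (UR i) in
  let unaffected :=
    [forall c : circle al, forall c' : circle al',
      (val c == val c') && (UL i \notin val c) && (UR i \notin val c)
      ==> (f c == f' c')] in
  let local :=
    if cL == cR then
      if cL' == cR' then coefV (mV (monoV (f cL))) (f' cL')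
      else DeltaV (monoV (f cL)) (f' cL', f' cR')
    else coefV (monoV (f cL) * monoV (f cR)) (f' cL') in
  unaffected%:R * local.

Definition sign_count (al : state G) (i : 'I_(ell G)) : nat :=
  #|[set j : 'I_(ell G) | (j < i)%N && al j]|.

Definition differential (v : chain) : chain :=
  [ffun s' => \sum_(s : gen)
     \sum_(i | ~~ tag s i && (tag s' == set_state (tag s) i true))
       (-1) ^+ sign_count (tag s) i * edge_coef i s s' * v s].

Definition grade : finType := ('I_n * 'I_(gpar n))%type.

Definition has_grade (s : gen) (g : grade) :=
  let deg1 := (\sum_c (2 * (tagged s c).1 + (tagged s c).2))%N in
  let deg2 := (\sum_c (tagged s c).2)%N in
  (deg1 %% n == g.1)%N && (deg2 %% gpar n == g.2)%N.

(* v lies in the degree g part of C^i *)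
Definition in_chain (i : nat) (g : grade) (v : chain) : Prop :=
  forall s, v s != 0 -> weight (tag s) = i /\ has_grade s g.

Definition is_cycle (i : nat) (g : grade) (v : chain) : Prop :=
  in_chain i g v /\ differential v = 0.

Definition is_boundary (i : nat) (g : grade) (v : chain) : Prop :=
  if i is j.+1 then exists2 u, in_chain j g u & v = differential u else v = 0.

(* r elements of MH^{i,g} = cycles / boundaries, given by representatives, which
   are linearly independent over R *)
Definition independent_classes (i : nat) (g : grade) (r : nat) : Prop :=
  exists z : 'I_r -> chain,
    (forall k, is_cycle i g (z k)) /\
    (forall a : 'I_r -> Zinv n,
       is_boundary i g (\sum_k a k *: z k) -> forall k, a k = 0).

(* The rank of the R-module MH^{i,g}: the largest number of R-linearly
   independent elements, which cannot exceed the rank of the chain module. *)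
Definition MH_rank (i : nat) (g : grade) : nat :=
  \max_(r < #|gen|.+1 | `[< independent_classes i g r >]) r.

Definition qdim_MH (i : nat) : Zqb n :=
  \sum_(g : grade) (MH_rank i g)%:R * (qvar n ^+ g.1 * bvar n ^+ g.2).

(* the graded Poincare polynomial, a polynomial in t over Zqb n *)
Definition Mh : {poly Zqb n} := \poly_(i < (ell G).+1) qdim_MH i.

End Homology.

(* Main.v *)
(** The Euler characteristic of a graded complex is that of its homology, and
    the graded Euler characteristic of the chain groups is the state sum of the
    bracket; so the first half amounts to d o d = 0.  For this, V is a Frobenius
    algebra with counit eps, and a chain is tested by pairing it with tensors
    w : half-edges -> V, every circle being paired with the product of w along
    it.  The adjoints of the edge maps then multiply w by the copairing (merge),
    by theta = m_V(1) (one circle to one circle), or by 1 (split), and two edge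
    maps commute because theta^2 is the handle element mu(Delta(1)) and because
    the partitions of the half-edges around a face determine the factors.

    For the second half, if every matching edge has an endpoint carrying a loop,
    then no smoothing changes the circles: the bracket vanishes and every edge
    map is m_V, whose image contains no element with constant term; so the
    constant 1 on the last state is a nonzero class in top degree.  Two such
    graphs with different numbers of matching edges have distinct Mh. *)

From HB Require Import structures.
Require Import Defs.
From mathcomp Require Import all_boot all_order all_fingroup all_algebra.
From mathcomp Require Import boolp zify ring.
(* A second time, as all_boot shadows [half] and [opp] of Defs. *)
Import Defs.
Set Implicit Arguments.
Unset Strict Implicit.
Unset Printing Implicit Defensive.
Import GRing.Theory Num.Theory.

(** * Smoothing changes and equivalence relations *)

(** Each state has its own circles, so the chain groups are tensor powers over different index sets,
    and squares of edge maps would have to be checked on every configuration of circles met by two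
    matching edges. Tensors over the fixed set of strand half-edges put the four states of a face in
    one space: an edge map then depends only on whether UL and UR share a circle before and after,
    and counting circles around the face settles what remains. The factor 1/(3n) comes from the
    handle element: with the coefficient of x^(n-1) y^2 as counit, each of the 3n basis elements
    contributes x^(n-1) y^2 to it; dividing the copairing by 3n leaves x^(n-1) y^2, which is the
    square of m_V(1) for both parities of n. Ranks are defined by independent classes over R; as R
    lies in the rationals, multiplication by nonzero integers turns them into ranks of rational
    matrices, where rank-nullity applies. *)

Lemma connect_stable (T : finType) (e : rel T) (A : pred T) x y :
  (forall u v, e u v -> A u -> A v) -> A x -> connect e x y -> A y.
Proof.
move=> Ae Ax /connectP [p ep ->] {y}; elim: p x Ax ep => //= u p IH x Ax.
by case/andP => xu; apply: IH; apply: Ae xu Ax.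
Qed.

(* A connected component of the graph with edges {x, s x} and {x, t x} is a
   single cycle of s \o t, reversed by t; a reflection of a cycle fixes 0, 1 or
   2 points, and a second fixed point exists because s has none. *)
Lemma dihedral_fixpoints (T : finType) (s t : T -> T) p :
    involutive s -> involutive t -> (forall x, s x != x) -> t p = p ->
  let e := [rel x y | (y == s x) || (y == t x)] in
  exists q, [/\ q != p, t q = q, connect e p q &
    forall y, t y = y -> connect e p y -> y = p \/ y = q].
Proof.
move=> sK tK sN tp e; pose f x := s (t x); pose g x := t (s x).
have fI : injective f by apply: inj_comp; [exact: can_inj sK|exact: can_inj tK].
have fg k x : iter k f (iter k g x) = x.
  by elim: k x => // k IH x; rewrite iterSr iterS /f /g tK sK IH.
have gf k x : iter k g (iter k f x) = x.
  by elim: k x => // k IH x; rewrite iterSr iterS /f /g sK tK IH.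
have tf k : t (iter k f p) = iter k g p.
  by elim: k => //= k <-.
have sf k : s (iter k.+1 f p) = iter k g p by rewrite iterS /f sK tf.
set N := fingraph.order f p; have N0 : 0 < N := fingraph.order_gt0 f p.
have fN : iter N f p = p := iter_order fI p.
have iter_eq k : iter k f p = p -> k < N -> k = 0.
  by move=> kp kN; rewrite -(findex_iter kN) kp findex0.
have fixk k : k < N -> t (iter k f p) = iter k f p -> k = 0 \/ k.*2 = N.
  rewrite tf => kN /(congr1 (iter k f)); rewrite fg -iterD addnn => /esym E.
  case: (ltnP k.*2 N) => h; first by have := iter_eq _ E h; lia.
  by move: E; rewrite -(subnK h) iterD fN => /iter_eq; lia.
have conf y : connect e p y -> fconnect f p y.
  apply: (@connect_stable _ e (fconnect f p)) => // u v /=.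
  have gN k : fconnect f p (iter k g p).
    by rewrite fconnect_sym // -{2}(fg k p) fconnect_iter.
  case/orP => /eqP -> /iter_findex <-; last by rewrite tf.
  case: (findex f p u) => [|k]; last by rewrite sf.
  by rewrite /= -{2}tp (fconnect_iter f 1).
have fcon k : connect e p (iter k f p).
  elim: k => //= k IH; apply: connect_trans IH _.
  apply: (@connect_trans _ _ (t (iter k f p))); apply: connect1 => /=.
    by rewrite eqxx orbT.
  by rewrite eqxx.
(* An odd order [N] would give [s] the fixed point f^((N+1)/2) p. *)
have [m Nm] : exists m, N = m.*2.
  case: (boolP (odd N)) => [oN|/even_halfK]; last by exists N./2.
  have := sN (iter (N./2).+1 f p); rewrite sf -[X in iter _ g X]fN.
  by rewrite {2}[N](_ : _ = N./2 + N./2.+1) ?iterD ?gf ?eqxx //; lia.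
exists (iter m f p); split.
- by apply/eqP => /iter_eq; lia.
- by rewrite tf -[in LHS]fN Nm -addnn iterD gf.
- exact: fcon.
- move=> y + /conf py; have kN := findex_max py.
  rewrite -(iter_findex py) => /(fixk _ kN) [-> | e2]; [by left|right].
  by congr iter; lia.
Qed.

(** * Joining two classes of an equivalence relation *)

Definition eqv (T : Type) (r : rel T) := [/\ reflexive r, symmetric r & transitive r].

Lemma eqv_connect (T : finType) (e : rel T) : symmetric e -> eqv (connect e).
Proof.
move=> es; split; [exact: connect0 | exact: sym_connect_sym | exact: connect_trans].
Qed.

Lemma eqv_left (T : Type) (r : rel T) x y z : eqv r -> r x y -> r x z = r y z.
Proof.
case=> rr rs rt xy; apply/idP/idP; last exact: rt.
by apply: rt; rewrite rs.
Qed.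

Lemma eqv_right (T : Type) (r : rel T) x y z : eqv r -> r x y -> r z x = r z y.
Proof. by move=> re xy; case: (re) => _ rs _; rewrite !(rs z) (eqv_left _ re xy). Qed.

Lemma eqv_eq (T : Type) (r r' : rel T) : r =2 r' -> eqv r -> eqv r'.
Proof.
move=> E [rr rs rt]; split=> [x|x y|y x z]; rewrite -!E //.
exact: rt.
Qed.

(** For an equivalence [r], this is the equivalence generated by [r] and the pair [p], [q]. No
    closure is taken, because a path needs the new pair at most once. *)
Definition join_rel (T : Type) (r : rel T) p q : rel T :=
  fun x y => [|| r x y, r x p && r q y | r x q && r p y].

Lemma join_rel_id (T : Type) (r : rel T) p q : eqv r -> r p q ->
  join_rel r p q =2 r.
Proof.
move=> re pq x y; rewrite /join_rel (eqv_right x re pq) (eqv_left y re pq) orbb.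
by case: (re) => _ _ rt; apply/orP/idP => [[//|/andP [] /rt]|]; [apply|left].
Qed.

Lemma eq_join_rel (T : Type) (r r' : rel T) p p' q q' : eqv r -> r =2 r' ->
  r p p' -> r q q' -> join_rel r p q =2 join_rel r' p' q'.
Proof.
move=> re E pp qq x y; rewrite /join_rel -!E.
by rewrite !(eqv_right x re pp, eqv_right x re qq, eqv_left y re pp, eqv_left y re qq).
Qed.

Lemma eq_join_rel_l (T : Type) (r r' : rel T) p q : r =2 r' ->
  join_rel r p q =2 join_rel r' p q.
Proof. by move=> E x y; rewrite /join_rel !E. Qed.

Lemma join_relE (T : Type) (r : rel T) p q : eqv r -> join_rel r p q p q.
Proof. by case=> rr _ _; rewrite /join_rel !rr orbT. Qed.

Definition add_edge (T : eqType) (B : rel T) p q : rel T :=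
  fun x y => [|| B x y, (x == p) && (y == q) | (x == q) && (y == p)].

Lemma add_edge_sym (T : eqType) (B : rel T) p q :
  symmetric B -> symmetric (add_edge B p q).
Proof.
move=> Bs x y; rewrite /add_edge Bs; congr (_ || _).
by rewrite orbC [(x == p) && _]andbC [(x == q) && _]andbC.
Qed.

Lemma connect_add_edge (T : finType) (B : rel T) p q : symmetric B ->
  connect (add_edge B p q) =2 join_rel (connect B) p q.
Proof.
move=> Bs; have Be := eqv_connect Bs; case: (Be) => rr rs rt.
have [_ rs' rt'] := eqv_connect (add_edge_sym p q Bs).
have sub x y : connect B x y -> connect (add_edge B p q) x y.
  by apply: connect_sub => u v uv; apply: connect1; rewrite /add_edge uv.
have pq : connect (add_edge B p q) p q by apply: connect1; rewrite /add_edge !eqxx orbT.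
move=> x y; apply/idP/idP; last first.
  case/or3P => [/sub //| /andP [/sub xp /sub qy] | /andP [/sub xq /sub py]].
    exact: rt' xp (rt' _ _ _ pq qy).
  by apply: rt' xq (rt' _ _ _ _ py); rewrite rs'.
apply: connect_stable; last by rewrite /join_rel rr.
move=> u v /or3P [/connect1 uv | /andP [/eqP -> /eqP ->] | /andP [/eqP -> /eqP ->]];
  rewrite /join_rel.
- by rewrite !(eqv_right _ Be uv).
- by rewrite !rr !andbT => /or3P [->|/andP [-> _]|->]; rewrite ?orbT.
- by rewrite !rr !andbT => /or3P [->|->|/andP [-> _]]; rewrite ?orbT.
Qed.

(** The trichotomy that selects the edge map: [r] and [r'] tell which half-edges share a circle
    before and after, and [a], [b] are the two top corners. A split is written as a merge read
    backwards. *)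
Inductive smoothing_change (T : Type) (r r' : rel T) (a b : T) : Prop :=
| Merge of ~~ r a b & r' =2 join_rel r a b
| Single of r a b & r' =2 r
| Split of ~~ r' a b & r =2 join_rel r' a b.

Lemma eq_smoothing_change (T : Type) (r r' s s' : rel T) a b :
  r =2 s -> r' =2 s' -> smoothing_change r r' a b -> smoothing_change s s' a b.
Proof.
move=> rs rs' [nab E|ab E|nab E]; [apply: Merge|apply: Single|apply: Split]; rewrite -?rs -?rs' //.
- by move=> x y; rewrite -rs' E (eq_join_rel_l _ _ rs).
- by move=> x y; rewrite -rs' E rs.
- by move=> x y; rewrite -rs E (eq_join_rel_l _ _ rs').
Qed.

(** [B] carries the arcs outside the matching edge, and a, b, c, d play UL, UR, DL, DR. The
    hypothesis lists the ways to pair four endpoints: vertical arcs close up under the 0-smoothing,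
    so the change merges; diagonal arcs close up under the 1-smoothing, so it splits; horizontal
    arcs give one circle under both. *)
Lemma four_endpoints (T : finType) (B : rel T) a b c d : symmetric B ->
  [\/ connect B a c && connect B b d && ~~ connect B a b,
      connect B a d && connect B b c && ~~ connect B a b |
      connect B a b && connect B c d] ->
  smoothing_change (connect (add_edge (add_edge B a c) b d))
                   (connect (add_edge (add_edge B a d) b c)) a b.
Proof.
move=> Bs H; have Be := eqv_connect Bs; have [rr rs rt] := Be.
have Ce p q : eqv (connect (add_edge B p q)) := eqv_connect (add_edge_sym p q Bs).
have CC p q p' q' : connect (add_edge (add_edge B p q) p' q') =2
    join_rel (connect (add_edge B p q)) p' q'.
  exact: connect_add_edge (add_edge_sym p q Bs).
have C p q := connect_add_edge p q Bs.
have idC p q : connect B p q -> connect (add_edge B p q) =2 connect B.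
  by move=> pq x y; rewrite C join_rel_id.
have sub p q x y : connect B x y -> connect (add_edge B p q) x y.
  by rewrite C /join_rel => ->.
(* Chords parallel to the two arcs connect nothing new; crossed chords join the arcs. *)
have one u v w z : connect B u w -> connect B v z ->
    (connect (add_edge (add_edge B u w) v z) =2 connect B) /\
    (connect (add_edge (add_edge B u z) v w) =2 join_rel (connect B) u v).
  move=> uw vz; split=> x y.
    by rewrite CC (eq_join_rel_l _ _ (idC _ _ uw)) join_rel_id.
  rewrite CC join_rel_id //; last first.
    rewrite C /join_rel [connect B z _]rs [connect B v u]rs; apply/or3P; apply: Or33.
    by rewrite vz uw.
  by rewrite C; apply: eq_join_rel; rewrite // rs.
case: H => [/andP [/andP [ac bd] nab]|/andP [/andP [ad bc] nab]|/andP [ab cd]].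
- have [E E'] := one _ _ _ _ ac bd; apply: Merge; first by rewrite E.
  by move=> x y; rewrite E' (eq_join_rel_l _ _ E).
- have [E E'] := one _ _ _ _ ad bc; apply: Split; first by rewrite E.
  by move=> x y; rewrite E' (eq_join_rel_l _ _ E).
- have two w z : connect B w z ->
    connect (add_edge (add_edge B a w) b z) =2 connect (add_edge B a w).
    move=> wz x y; rewrite CC join_rel_id // C /join_rel; apply/or3P; apply: Or32.
    by rewrite rs ab wz.
  apply: Single => [|x y]; first by rewrite two // sub.
  rewrite two 1?rs // two // !C.
  by apply: eq_join_rel => //; rewrite rs.
Qed.

(** * Corners of the matching edges *)

Section Corners.
Variable G : tpmgraph.
Local Notation X := (strand_half G).
Implicit Types (al : state G) (i j : 'I_(ell G)) (x y : X).

Lemma opp_matched (h : half G) : (opp h \in @matched G) = (h \in @matched G).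
Proof.
rewrite !inE; apply: eq_existsb => i; rewrite /on_edge orbC.
by rewrite (inj_eq (can_inj (@oppK G))) (can2_eq (@oppK G) (@oppK G)).
Qed.

Lemma opp_strand_proof x : opp (val x) \notin @matched G.
Proof. by rewrite opp_matched (valP x). Qed.
Definition opp_strand x : X := exist _ (opp (val x)) (opp_strand_proof x).

Lemma opp_strandK : involutive opp_strand.
Proof. by move=> x; apply: val_inj; rewrite /= oppK. Qed.
Lemma opp_strand_neq x : opp_strand x != x.
Proof. by rewrite -val_eqE /= opp_neq. Qed.

(* A corner is (matching edge, top?, left?). *)
Definition corner (c : 'I_(ell G) * bool * bool) : X :=
  let: (i, t, s) := c in
  if t then (if s then UL i else UR i) else (if s then DL i else DR i).

Arguments corner : simpl never.

Definition corner_base (i : 'I_(ell G)) (t : bool) : half G := if t then medge i else opp (medge i).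

Lemma corner_base_matched i t : corner_base i t \in @matched G.
Proof. by case: t; [exact: medge_matched | exact: opp_medge_matched]. Qed.

Lemma corner_base_inj i t j u : corner_base i t = corner_base j u -> i = j /\ t = u.
Proof.
have E k l : on_edge (medge k) (medge l) -> k = l by exact: medge_inj.
case: t u => -[] /= e.
- by split=> //; apply: E; rewrite /on_edge e eqxx.
- have ij : i = j by apply/esym/E; rewrite /on_edge e eqxx orbT.
  by have := opp_neq (medge j); rewrite -e ij eqxx.
- have ij : i = j by apply: E; rewrite /on_edge -e eqxx orbT.
  by have := opp_neq (medge j); rewrite -{1}ij e eqxx.
- by split=> //; apply: E; rewrite /on_edge (can_inj (@oppK G) e) eqxx.
Qed.

(** Counterclockwise from the matched half-edge, the right corner comes first at the top and the
    left corner first at the bottom; hence the exclusive or. *)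
Lemma val_corner i t s : val (corner (i, t, s)) =
  if t (+) s then rot (corner_base i t) else rot (rot (corner_base i t)).
Proof. by case: t s => -[]. Qed.

(** The vertex of a corner has a single matched half-edge, which recovers the edge and its end; the
    side is the number of rotations from it. *)
Lemma corner_inj : injective corner.
Proof.
have orb i t s : val (corner (i, t, s)) \in porbit rot (corner_base i t).
  rewrite val_corner; case: ifP => _; first exact: (mem_porbit rot 1).
  by have := mem_porbit rot 2 (corner_base i t); rewrite permX.
move=> [[i t] s] [[j u] v] E.
have /corner_base_inj [ij tu] : corner_base i t = corner_base j u.
  apply: matched_uniq; rewrite ?corner_base_matched //.
  rewrite -eq_porbit_mem (eqP (_ : porbit rot _ == porbit rot (val (corner (i, t, s))))).
    by rewrite E eq_porbit_mem orb.
  by rewrite eq_sym eq_porbit_mem orb.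
congr (_, _, _) => //; move: E => /(congr1 val); rewrite !val_corner ij tu.
have /andP [N _] := rot_neq (rot (corner_base j u)).
by case: u s v {tu} N => -[] [] //= /eqP N e; case: N.
Qed.

Lemma corner_surj x : exists c, corner c == x.
Proof.
have /eqP/cards1P [k kP] := medge_perfect (val x).
have : k \in [set k] by rewrite inE.
rewrite -kP inE => /andP [ox /existsP [i ki]].
have [t tk] : exists t, k = corner_base i t.
  by case/orP: ki => /eqP ->; [exists true | exists false].
have : val x \in porbit rot k by rewrite porbit_sym.
rewrite porbit_traject tpm_trivalent !inE => /or3P [] /eqP e.
- by have := valP x; rewrite [X in X \notin _]e tk corner_base_matched.
- exists (i, t, ~~ t); rewrite -val_eqE val_corner e tk.
  by case: (t).
- exists (i, t, t); rewrite -val_eqE val_corner e tk.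
  by case: (t).
Qed.

Definition corner_of x := xchoose (corner_surj x).
Lemma corner_ofK : cancel corner_of corner.
Proof. by move=> x; apply/eqP/(xchooseP (corner_surj x)). Qed.
Lemma cornerK : cancel corner corner_of.
Proof. exact: inj_can_sym corner_ofK corner_inj. Qed.

(** * The arcs outside one matching edge *)

Definition joined_at al j x y :=
  if al j then (x == UL j) && (y == DR j) || (x == UR j) && (y == DL j)
  else (x == UL j) && (y == DL j) || (x == UR j) && (y == DR j).

(** In corner coordinates both smoothings are one formula: top goes to bottom, and the side changes
    exactly when [al j] holds. *)
Lemma joined_atE al j x y : joined_at al j x y =
  (corner_of x == (j, true, (corner_of x).2)) && (y == corner (j, false, (corner_of x).2 (+) al j)).
Proof.
rewrite /joined_at -[x]corner_ofK; case: (corner_of x) => [[k t] s].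
rewrite cornerK [(_, _, s).2]/= -[UL j]/(corner (j, true, true)) -[UR j]/(corner (j, true, false)).
rewrite !(inj_eq corner_inj) -!pair_eqE /= eqxx andbT; case: (_ == (j, true)) => /=.
  by case: s (al j) => -[]; rewrite /= ?orbF.
by case: ifP.
Qed.

(** The strand graph with the two chords at the i-th matching edge removed: it does not see the
    entry of [al] at [i]. *)
Definition base_rel al i : rel X := fun x y => (val y == opp (val x)) ||
  [exists j, (j != i) && (joined_at al j x y || joined_at al j y x)].

Lemma base_rel_sym al i : symmetric (base_rel al i).
Proof.
move=> x y; congr (_ || _); last by apply: eq_existsb => j; rewrite orbC.
by rewrite -(inj_eq (can_inj (@oppK G))) oppK eq_sym.
Qed.

Lemma strandE al i x y : strand al x y =
  [|| base_rel al i x y, joined_at al i x y | joined_at al i y x].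
Proof.
rewrite /strand /base_rel -!orbA; congr (_ || _); apply/idP/idP.
  case/orP => /existsP [j]; have [->|ji] := eqVneq j i; rewrite -/(joined_at _ _ _ _) => h.
  - by rewrite h orbT.
  - by apply/orP; left; apply/existsP; exists j; rewrite ji h.
  - by rewrite h !orbT.
  - by apply/orP; left; apply/existsP; exists j; rewrite ji h orbT.
case/or3P => [/existsP [j /andP [_ /orP []]] | | ] h; apply/orP.
- by left; apply/existsP; exists j.
- by right; apply/existsP; exists j.
- by left; apply/existsP; exists i.
- by right; apply/existsP; exists i.
Qed.

(** The involution following the chords at all edges but the i-th. Its fixed points are the four
    corners of that edge, while [opp_strand] has none, as required for [dihedral_fixpoints]. *)
Definition flip al i x : X :=
  let: (j, t, s) := corner_of x in
  if j == i then x else corner (j, ~~ t, s (+) al j).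

Lemma flipK al i : involutive (flip al i).
Proof.
move=> x; rewrite {2}/flip; case e: (corner_of x) => [[j t] s].
case: ifP => ji; first by rewrite /flip e ji.
by rewrite /flip cornerK ji negbK addbK -e corner_ofK.
Qed.

Lemma flip_corner al i t s : flip al i (corner (i, t, s)) = corner (i, t, s).
Proof. by rewrite /flip cornerK eqxx. Qed.

Lemma flip_fix al i x : flip al i x = x -> exists t s, x = corner (i, t, s).
Proof.
rewrite /flip; case e: (corner_of x) => [[j t] s].
case: ifP => [/eqP ji _|ji].
  by exists t, s; rewrite -ji -e corner_ofK.
by rewrite -[X in _ = X -> _]corner_ofK e => /corner_inj []; case: t {e}.
Qed.

Lemma connect_baseE al i :
  connect (base_rel al i) =2
  connect [rel x y | (y == opp_strand x) || (y == flip al i x)].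
Proof.
move=> x y; apply/idP/idP; apply: connect_sub => {x y} x y /=.
  case/orP => [e|]; first by apply: connect1 => /=; rewrite -val_eqE /= e.
  case/existsP => j /andP [ji /orP []]; rewrite joined_atE => /andP [/eqP e /eqP ->].
    by apply: connect1; rewrite /= /flip e (negbTE ji) /= eqxx orbT.
  apply: connect1 => /=; apply/orP; right; rewrite /flip cornerK (negbTE ji) /=.
  by rewrite addbK -e corner_ofK.
case/orP => /eqP ->; first by apply: connect1; rewrite /base_rel /= eqxx.
rewrite /flip; case e: (corner_of x) => [[j t] s].
case: ifP => ji; first exact: connect0.
apply: connect1; apply/orP; right; apply/existsP; exists j; rewrite ji /=.
rewrite !joined_atE cornerK e /=; case: t e => e; rewrite /= !eqxx //=.
by rewrite addbK -{1}[x]corner_ofK e eqxx orbT.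
Qed.

(** Each arc left after removing the chords at the i-th edge has exactly two ends among its corners,
    the two fixed points of the reflection [flip]. *)
Lemma base_pairing al i t s : exists u v, [/\ (u, v) != (t, s),
  connect (base_rel al i) (corner (i, t, s)) (corner (i, u, v)) &
  forall w z, connect (base_rel al i) (corner (i, t, s)) (corner (i, w, z)) ->
    (w, z) = (t, s) \/ (w, z) = (u, v)].
Proof.
have [q [qp qf pq qU]] := dihedral_fixpoints opp_strandK (@flipK al i) opp_strand_neq
  (flip_corner al i t s).
have [u [v e]] := flip_fix qf; rewrite e in qp pq qU; exists u, v; split.
- by apply: contra qp => /eqP [-> ->].
- by rewrite connect_baseE.
- move=> w z; rewrite connect_baseE => /(qU _ (flip_corner al i w z)).
  by case=> /corner_inj [-> ->]; [left|right].
Qed.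

Lemma base_rel_set_state al i b : base_rel (set_state al i b) i =2 base_rel al i.
Proof.
move=> x y; congr (_ || _); apply: eq_existsb => j.
by case: (eqVneq j i) => //= /negbTE ji; rewrite /joined_at ffunE ji.
Qed.

Lemma strand0E al i : al i = false ->
  strand al =2 add_edge (add_edge (base_rel al i) (UL i) (DL i)) (UR i) (DR i).
Proof.
move=> ai x y; rewrite (strandE al i) /add_edge /joined_at ai.
by case: (base_rel _ _ _ _) (x == UL i) (x == UR i) (x == DL i) (x == DR i)
  (y == UL i) (y == UR i) (y == DL i) (y == DR i) => -[] [] [] [] [] [] [] [].
Qed.

Lemma strand1E al i : al i = true ->
  strand al =2 add_edge (add_edge (base_rel al i) (UL i) (DR i)) (UR i) (DL i).
Proof.
move=> ai x y; rewrite (strandE al i) /add_edge /joined_at ai.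
by case: (base_rel _ _ _ _) (x == UL i) (x == UR i) (x == DL i) (x == DR i)
  (y == UL i) (y == UR i) (y == DL i) (y == DR i) => -[] [] [] [] [] [] [] [].
Qed.

Lemma smoothing_changeP al i : al i = false ->
  smoothing_change (connect (strand al)) (connect (strand (set_state al i true))) (UL i) (UR i).
Proof.
move=> ai; set B := base_rel al i; have Bs := base_rel_sym al i : symmetric B.
have [_ rs rt] := eqv_connect Bs.
apply: eq_smoothing_change (four_endpoints (a := UL i) (b := UR i) (c := DL i) (d := DR i) Bs _).
- by apply: eq_connect => x y; exact/esym/(strand0E ai).
- apply: eq_connect => x y; rewrite (@strand1E _ i) ?ffunE ?eqxx //.
  by rewrite /add_edge base_rel_set_state.
have pair t s : exists u v, [/\ (u, v) != (t, s),
    connect B (corner (i, t, s)) (corner (i, u, v)) &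
    forall w z, connect B (corner (i, t, s)) (corner (i, w, z)) ->
    (w, z) = (t, s) \/ (w, z) = (u, v)] := base_pairing al i t s.
rewrite -[UL i]/(corner (i, true, true)) -[UR i]/(corner (i, true, false)).
rewrite -[DL i]/(corner (i, false, true)) -[DR i]/(corner (i, false, false)).
(* The partner of UL decides the case; the remaining two corners are then paired with each other. *)
have [u [v [uv ab U]]] := pair true true.
case: u v uv ab U => -[] //= _ ab U.
- apply: Or33; rewrite ab /=; have [w [z [wz cd _]]] := pair false true.
  case: w z wz cd => -[] //= _ cd.
    by case: (U false true _) => //; rewrite rs.
  by case: (U false true _) => //; apply: rt ab _; rewrite rs.
- have nab : ~~ connect B (corner (i, true, true)) (corner (i, true, false)).
    by apply/negP => /U [].
  apply: Or31; rewrite ab nab andbT /=; have [w [z [wz cd _]]] := pair true false.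
  case: w z wz cd => -[] //= _ cd; first by rewrite rs cd in nab.
  by rewrite (rt _ _ _ ab) // rs in nab.
- have nab : ~~ connect B (corner (i, true, true)) (corner (i, true, false)).
    by apply/negP => /U [].
  apply: Or32; rewrite ab nab andbT /=; have [w [z [wz cd _]]] := pair true false.
  case: w z wz cd => -[] //= _ cd; first by rewrite rs cd in nab.
  by rewrite (rt _ _ _ ab) // rs in nab.
Qed.

End Corners.

Local Open Scope ring_scope.

(** * The Frobenius algebra V *)

Section QuotientPoly.
Variables (A : comNzRingType) (h : {poly A}).
Hypotheses (h_gt1 : (1 < size h)%N) (h_monic : h \is monic).

(** [{poly %/ h}] really divides by [mk_monic h], which falls back to ['X] unless [h] is monic and
    nonconstant. *)
Lemma mk_monicE : mk_monic h = h.
Proof. by rewrite /mk_monic h_gt1 h_monic. Qed.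

Lemma qXnE k : ('qX ^+ k : {poly %/ h}) = in_qpoly h 'X^k.
Proof. by rewrite rmorphXn. Qed.

Lemma qXn_small k : (k < (size h).-1)%N ->
  ('qX ^+ k : {poly %/ h}) = 'X^k :> {poly A}.
Proof.
by move=> kh; rewrite qXnE in_qpoly_small // mk_monicE size_polyXn;
  case: (size h) kh h_gt1 => [|[]].
Qed.

Lemma in_qpoly_self : in_qpoly h h = 0.
Proof. by apply/val_inj; rewrite /= mk_monicE Pdiv.RingMonic.rmodpp. Qed.

Lemma qpolyC_mulE c (v : {poly %/ h}) : qpolyC h c * v = c *: (v : {poly A}) :> {poly A}.
Proof.
rewrite poly_of_qpolyM qpolyCE mul_polyC Pdiv.CommonRing.rmodp_small //.
exact: leq_ltn_trans (size_scale_leq _ _) (size_mk_monic _).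
Qed.

Lemma qpoly_basis (v : {poly %/ h}) :
  v = \sum_(i < (size h).-1) qpolyC h v`_i * 'qX ^+ i.
Proof.
apply/val_inj; rewrite /= raddf_sum /=.
under eq_bigr => i _ do rewrite -[Pdiv.CommonRing.rmodp _ _]/(polyn (qpolyC h v`_i
  * _)) qpolyC_mulE qXn_small //.
rewrite -poly_def; apply/polyP => i; rewrite coef_poly; case: ltnP => // hi.
by rewrite nth_default // -ltnS (leq_trans (size_mk_monic v)) // mk_monicE;
  case: (size h) hi h_gt1 => [|[]].
Qed.

End QuotientPoly.

(** The three terms for a fixed i in the handle element: [x], [z], [w], [e] stand for x^i,
    x^(n-1-i), x^(n-i), x^(n-1). *)
Lemma dual_mono_terms (A : comPzRingType) (x y z w e : A) : z * x = e -> w * x = 0 ->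
  (z * y ^+ 2 - w) * (x * y ^+ 0) + z * (y * (x * y ^+ 1)) + z * (x * y ^+ 2) = 3%:R * (e * y ^+ 2).
Proof. by move=> <- wx; rewrite expr0 mulr1 mulrBl wx; ring. Qed.

Lemma dual_Delta_terms (A : comPzRingType) (e w a b c q q' q'' : A) :
  e * (- (w * q) + (a * q + b * q' + c * q'')) = e * (a - w) * q + e * b * q' + e * c * q''.
Proof. ring. Qed.

Section FrobeniusAlgebra.
Variables (n : nat) (n_gt0 : (0 < n)%N).
Local Notation R := (Zinv n).

Let size_Xn : size ('X^n : {poly R}) = n.+1. Proof. exact: size_polyXn. Qed.
Let Xn_gt1 : (1 < size ('X^n : {poly R}))%N. Proof. by rewrite size_Xn. Qed.
Let Xn_monic : ('X^n : {poly R}) \is monic. Proof. exact: monicXn. Qed.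

Local Notation hy := ('X^3 - ('qX : Vx n)%:P * 'X : {poly Vx n}).

Lemma size_hy_aux : (size (- (('qX : Vx n)%:P * 'X)) < size ('X^3 : {poly Vx n}))%N.
Proof.
rewrite size_polyN size_polyXn mul_polyC.
by rewrite (leq_ltn_trans (size_scale_leq _ _)) // size_polyX.
Qed.

Lemma size_hy : size hy = 4%N.
Proof. by rewrite size_polyDl ?size_hy_aux // size_polyXn. Qed.
Lemma hy_monic : hy \is monic.
Proof. by rewrite monicE lead_coefDl ?size_hy_aux // lead_coefXn. Qed.
Let hy_gt1 : (1 < size hy)%N. Proof. by rewrite size_hy. Qed.

Definition iota (r : R) : V n := qpolyC hy (qpolyC _ r).

Fact iota_is_zmod_morphism : zmod_morphism iota.
Proof. by move=> r s; rewrite /iota !rmorphB. Qed.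

Fact iota_is_monoid_morphism : monoid_morphism iota.
Proof. by split=> [|r s]; rewrite /iota ?rmorph1 ?rmorphM. Qed.

HB.instance Definition _ :=
  GRing.isZmodMorphism.Build R (V n) iota iota_is_zmod_morphism.
HB.instance Definition _ :=
  GRing.isMonoidMorphism.Build R (V n) iota iota_is_monoid_morphism.

Lemma coefVD p : {morph (fun v : V n => coefV v p) : u v / u + v}.
Proof. by move=> u v; rewrite /coefV !coefD. Qed.

Lemma coefV0 p : coefV (0 : V n) p = 0.
Proof. by rewrite /coefV !coef0. Qed.

Lemma coefVN p : {morph (fun v : V n => coefV v p) : v / - v}.
Proof. by move=> v; rewrite /coefV !coefN. Qed.

Lemma coef_constV (c : Vx n) (v : V n) j :
  ((qpolyC hy c : V n) * v : {poly Vx n})`_j = c * v`_j.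
Proof. by rewrite -coefZ -qpolyC_mulE. Qed.

Lemma coef_constVx (r : R) (v : Vx n) i :
  ((qpolyC 'X^n r : Vx n) * v : {poly R})`_i = r * v`_i.
Proof. by rewrite -coefZ -qpolyC_mulE. Qed.

Lemma coefV_iota r (v : V n) p : coefV (iota r * v) p = r * coefV v p.
Proof. by rewrite /coefV coef_constV coef_constVx. Qed.

Lemma xVX k : xV n ^+ k = qpolyC hy ('qX ^+ k).
Proof. by rewrite rmorphXn. Qed.

Lemma xVn : xV n ^+ n = 0.
Proof.
have -> : xV n ^+ n = qpolyC hy ('qX ^+ n) := xVX n.
by rewrite qXnE in_qpoly_self // raddf0.
Qed.

Lemma yV3 : yV n ^+ 3 = xV n * yV n.
Proof.
apply/eqP; rewrite -subr_eq0; apply/eqP.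
rewrite -[RHS](in_qpoly_self hy_gt1 hy_monic) rmorphB rmorphXn /= rmorphM /=.
suff -> : in_qpoly hy ('qX)%:P = xV n by [].
apply/val_inj; rewrite /= Pdiv.CommonRing.rmodp_small //.
exact: leq_ltn_trans (size_polyC_leq1 _) (size_mk_monic_gt1 _).
Qed.

Lemma coef_yVX k j : (k < 3)%N ->
  ((yV n ^+ k : V n) : {poly Vx n})`_j = (j == k)%:R.
Proof.
move=> k3; rewrite -coefXn; congr (_ : {poly _})`_j.
by apply: qXn_small => //; [exact: hy_monic | rewrite size_hy].
Qed.

Lemma coef_qxX k j : (k < n)%N ->
  (('qX ^+ k : Vx n) : {poly R})`_j = (j == k)%:R.
Proof.
move=> kn; rewrite -coefXn; congr (_ : {poly _})`_j.
by apply: qXn_small; rewrite ?size_Xn.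
Qed.

Lemma coefV_mono p q : coefV (monoV p) q = (p == q)%:R :> R.
Proof.
rewrite /coefV /monoV xVX coef_constV coef_yVX // mulr_natr.
rewrite -pair_eqE /pair_eq /= -!val_eqE /= eq_sym [_ == val q.2 :> nat]eq_sym.
case: (val q.2 == p.2); first by rewrite mulr1n coef_qxX // andbT eq_sym.
by rewrite mulr0n coef0 andbF.
Qed.

Lemma monoV_expand v : v = \sum_(p : mono n) iota (coefV v p) * monoV p.
Proof.
transitivity (\sum_(i < n) \sum_(j < 3) iota (coefV v (i, j)) * monoV (i, j)).
  rewrite exchange_big /= [LHS](qpoly_basis hy_gt1 hy_monic) size_hy.
  apply: eq_bigr => j _ /=; rewrite [v`_j](qpoly_basis Xn_gt1 Xn_monic) size_Xn.
  rewrite raddf_sum big_distrl /=; apply: eq_bigr => i _.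
  by rewrite rmorphM -mulrA /monoV /= xVX.
by rewrite pair_big; apply: eq_bigr => -[i j] _.
Qed.

Lemma coefV_inj (u v : V n) : (forall p, coefV u p = coefV v p) -> u = v.
Proof.
by move=> uv; rewrite (monoV_expand u) (monoV_expand v); apply: eq_bigr => p _; rewrite uv.
Qed.

(** The relation y^3 = xy is homogeneous for the integer degree 2a + b and for the parity of b, and
    x^n = 0 only kills terms. Both parts of the grading come from this, before any reduction modulo
    n. *)
Lemma coefV_xy a b p : coefV (xV n ^+ a * yV n ^+ b) p != 0 ->
  (2 * p.1 + p.2 = 2 * a + b)%N /\ (p.2 = b %[mod 2]).
Proof.
elim/ltn_ind: b a => b IH a; case: (ltnP b 3) => [b3|b3].
  case: (ltnP a n) => [an|na]; last first.
    by rewrite -(subnK na) exprD xVn mulr0 mul0r coefV0 eqxx.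
  have -> : xV n ^+ a * yV n ^+ b = monoV (Ordinal an, Ordinal b3) by [].
  by rewrite coefV_mono; case: (eqVneq (_, _) p) => [<- //|_]; rewrite eqxx.
rewrite -{1}(subnK b3) exprD yV3 [_ ^+ (b - 3) * _]mulrCA -exprSr mulrA -exprSr => nz.
have [] := IH _ _ _ nz; first lia.
by move=> e1 e2; split; lia.
Qed.

(** * Counit, dual basis and handle element *)

Definition top : mono n := (Ordinal (ltac:(rewrite prednK //) : (n.-1 < n)%N), ord_max).

(** The counit: 3n times the coefficient of x^(n-1) y^2. The unit 3n cancels the number of basis
    elements in the handle element. *)
Definition eps (v : V n) : R := (3 * n)%:R * coefV v top.

Lemma epsD : {morph eps : u v / u + v}.
Proof. by move=> u v; rewrite /eps coefVD mulrDr. Qed.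
Lemma eps0 : eps 0 = 0.
Proof. by rewrite /eps coefV0 mulr0. Qed.
Lemma eps_sum I (r : seq I) (P : pred I) (F : I -> V n) :
  eps (\sum_(i <- r | P i) F i) = \sum_(i <- r | P i) eps (F i).
Proof. exact: (big_morph _ epsD eps0). Qed.
Lemma eps_iota r v : eps (iota r * v) = r * eps v.
Proof. by rewrite /eps coefV_iota mulrCA. Qed.

Lemma inv3nK : inv3n n * (3 * n)%:R = 1.
Proof.
apply: val_inj; rewrite rmorphM rmorph_nat rmorph1 /= mulVf //.
by rewrite pnatr_eq0 muln_eq0 /= -lt0n.
Qed.


Lemma coefV_top_xy a b : (b < 5)%N -> coefV (xV n ^+ a * yV n ^+ b) top =
  ((b == 2%N) && (a == n.-1) || (b == 4%N) && (a.+1 == n.-1))%:R.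
Proof.
move=> b5; have [-> |] := eqVneq b 4%N.
  rewrite /= (_ : xV n ^+ a * _ = xV n ^+ a.+1 * yV n ^+ 2); last first.
    by rewrite (exprSr (xV n) a) -mulrA (exprS (yV n) 3) yV3 expr2 (mulrCA (yV n)).
  case: (ltnP a.+1 n) => [an|na].
    rewrite [_ * _](_ : _ = monoV (Ordinal an, ord_max)) // coefV_mono.
    by rewrite -pair_eqE /= eqxx andbT.
  by rewrite -(subnK na) exprD xVn mulr0 mul0r coefV0; case: eqP => //; lia.
move=> b4; have [-> |] := eqVneq b 3%N.
  rewrite /= (_ : xV n ^+ a * _ = xV n ^+ a.+1 * yV n ^+ 1); last first.
    by rewrite yV3 exprSr expr1 mulrA.
  case: (ltnP a.+1 n) => [an|na].
    rewrite [_ * _](_ : _ = monoV (Ordinal an, Ordinal (isT : 1 < 3)%N)) //.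
    by rewrite coefV_mono -pair_eqE /= andbF.
  by rewrite -(subnK na) exprD xVn mulr0 mul0r coefV0.
move=> b3; have {b4 b3 b5} b3 : (b < 3)%N by lia.
case: (ltnP a n) => [an|na].
  rewrite [_ * _](_ : _ = monoV (Ordinal an, Ordinal b3)) // coefV_mono.
  by rewrite -pair_eqE /= -!val_eqE /= andbC; congr (nat_of_bool _)%:R; lia.
by rewrite -(subnK na) exprD xVn mulr0 mul0r coefV0 [_ || _](_ : _ = false) //; lia.
Qed.

(** The basis dual to the monomials under [eps] of the product. As y^4 = x y^2, the product of
    x^(n-1-i) y^2 with x^(i-1) y^2 also reaches the top monomial; the term - x^(n-i) cancels it. *)
Definition dualV (p : mono n) : V n := iota (inv3n n) *
  match val p.2 with
  | 0 => xV n ^+ (n.-1 - p.1) * yV n ^+ 2 - xV n ^+ (n - p.1)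
  | 1 => xV n ^+ (n.-1 - p.1) * yV n
  | _ => xV n ^+ (n.-1 - p.1)
  end.

Lemma eps_dualV v p : eps (v * dualV p) = coefV v p.
Proof.
rewrite [v in LHS]monoV_expand big_distrl eps_sum /=.
transitivity (\sum_q coefV v q * (q == p)%:R); last first.
  rewrite (bigD1 p) //= eqxx mulr1 big1 ?addr0 // => q /negbTE ->.
  by rewrite mulr0.
apply: eq_bigr => q _; rewrite -mulrA eps_iota; congr (_ * _).
rewrite mulrCA eps_iota /eps mulrA inv3nK mul1r.
case: q p => [k l] [i j]; rewrite /monoV -pair_eqE /=.
have sh a b : xV n ^+ k * yV n ^+ l * (xV n ^+ a * yV n ^+ b) = xV n ^+ (k + a) * yV n ^+ (l + b).
  by rewrite mulrACA !exprD.
have sh1 a : xV n ^+ k * yV n ^+ l * (xV n ^+ a * yV n) = xV n ^+ (k + a) * yV n ^+ (l + 1).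
  by rewrite -sh expr1.
have sh0 a : xV n ^+ k * yV n ^+ l * xV n ^+ a = xV n ^+ (k + a) * yV n ^+ l.
  by rewrite -[xV n ^+ a]mulr1 (sh a 0%N) addn0.
have := ltn_ord i; have := ltn_ord k.
case: j => [[|[|[|//]]]] /= j3 kn lin; rewrite -!val_eqE /=;
  rewrite ?mulrBr ?(coefVD, coefVN) ?sh ?sh1 ?sh0 !coefV_top_xy //; try by have := ltn_ord l; lia.
all: case: l {sh sh1 sh0} => [[|[|[|//]]]] l3 /=; rewrite ?orbF ?andbT ?andbF ?subr0 ?subrr //.
- by congr (nat_of_bool _)%:R; lia.
- by apply/eqP; rewrite subr_eq0; apply/eqP; congr (nat_of_bool _)%:R; lia.
- by congr (nat_of_bool _)%:R; lia.
- by congr (nat_of_bool _)%:R; lia.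
Qed.

Lemma eps_dualV_sum u w : \sum_p eps (u * dualV p) * eps (monoV p * w) = eps (u * w).
Proof.
rewrite [u in RHS]monoV_expand big_distrl eps_sum; apply: eq_bigr => p _ /=.
by rewrite eps_dualV -mulrA eps_iota.
Qed.

Lemma sum_ord_rev (U : nmodType) (F : nat -> U) :
  \sum_(i < n) F (n.-1 - i)%N = \sum_(i < n) F i.
Proof.
rewrite (reindex_inj rev_ord_inj) /=; apply: eq_bigr => i _.
by congr F; have := ltn_ord i; lia.
Qed.

Lemma big_mono (U : nmodType) (F : mono n -> U) :
  \sum_p F p = \sum_(i < n) (F (i, ord0) + F (i, Ordinal (isT : 1 < 3)%N) + F (i, ord_max)).
Proof.
transitivity (\sum_(i < n) \sum_(j < 3) F (i, j)).
  by rewrite pair_big; apply: eq_bigr => -[i j] _.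
apply: eq_bigr => i _; rewrite !big_ord_recl big_ord0 addr0 addrA.
by congr (_ + F (i, _) + F (i, _)); apply: val_inj.
Qed.

Lemma dualV_mul_mono : \sum_p dualV p * monoV p = xV n ^+ n.-1 * yV n ^+ 2.
Proof.
rewrite big_mono; transitivity (\sum_(i < n) iota (inv3n n * 3) * (xV n ^+ n.-1 * yV n ^+ 2)).
  apply: eq_bigr => i _; rewrite /monoV /dualV /=.
  have e1 : xV n ^+ (n.-1 - i) * xV n ^+ i = xV n ^+ n.-1.
    by rewrite -exprD subnK //; have := ltn_ord i; lia.
  have e2 : xV n ^+ (n - i) * xV n ^+ i = 0.
    by rewrite -exprD subnK ?xVn //; have := ltn_ord i; lia.
  rewrite rmorphM rmorph_nat -!mulrA -!mulrDr; congr (_ * _).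
  exact: dual_mono_terms.
rewrite -big_distrl -raddf_sum sumr_const card_ord /=.
rewrite -mulrnAr -mulrnA.
by rewrite inv3nK rmorph1 mul1r.
Qed.

(** This identifies the explicit formula for Delta with the comultiplication dual to the product. *)
Lemma DeltaVE v p q : DeltaV v (p, q) = eps (v * dualV p * dualV q).
Proof.
rewrite mulrAC eps_dualV.
transitivity (\sum_r coefV (v * dualV r) p * coefV (monoV r) q); last first.
  rewrite (bigD1 q) //= coefV_mono eqxx mulr1 big1 ?addr0 // => r /negbTE rq.
  by rewrite coefV_mono rq mulr0.
pose F i := coefV (v * xV n ^+ (n - i)) p * coefV (xV n ^+ i) q.
(* The added term i = 0 vanishes because x^n = 0, so both sums of [DeltaV] run over all powers of x,
   as the basis does. *)
have F0 : \sum_(1 <= i < n) F (n - i)%N = \sum_(i < n) F i.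
  rewrite -(big_mkord xpredT) big_ltn // {2}/F subn0 xVn mulr0 coefV0 mul0r add0r.
  by rewrite big_nat_rev; apply: eq_big_nat => i hi; congr F; lia.
pose G s := coefV (v * xV n ^+ s * yV n ^+ 2) p * coefV (xV n ^+ (n.-1 - s)) q
  + coefV (v * xV n ^+ s * yV n) p * coefV (xV n ^+ (n.-1 - s) * yV n) q
  + coefV (v * xV n ^+ s) p * coefV (xV n ^+ (n.-1 - s) * yV n ^+ 2) q.
transitivity (- (inv3n n * \sum_(1 <= i < n) F (n - i)%N) + inv3n n * \sum_(s < n) G s).
  rewrite /DeltaV !ffunE; congr (- (_ * _) + _ * _); rewrite sum_ffunE.
    by apply: eq_big_nat => i hi; rewrite ffunE /F /= subKn //; lia.
  by rewrite big_mkord; apply: eq_bigr => i _; rewrite !ffunE.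
rewrite F0 -(sum_ord_rev G) big_mono -mulrN -mulrDr -sumrN -big_split mulr_sumr /=.
apply: eq_bigr => i _; rewrite /dualV /F /G /= /monoV /= expr0 expr1 !mulr1.
rewrite subKn; last by have := ltn_ord i; lia.
rewrite !(mulrCA v) !coefV_iota !mulrBr !(coefVD, coefVN) !mulrA [xV n ^+ _ * v]mulrC.
exact: dual_Delta_terms.
Qed.

Definition theta : V n :=
  if odd n then xV n ^+ n.-1./2 * yV n else xV n ^+ (n - 2)./2 * yV n ^+ 2.

Lemma mVE v : mV v = v * theta.
Proof. by rewrite /mV /theta; case: ifP. Qed.

(** Both sides are x^(n-1) y^2. For even n the square is x^(n-2) y^4, and y^4 = x y^2 supplies the
    last factor x. *)
Lemma theta2 : theta * theta = \sum_p dualV p * monoV p.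
Proof.
rewrite dualV_mul_mono /theta; case: ifP => on; rewrite mulrACA -!exprD.
  by rewrite addnn; congr (_ ^+ _ * _); lia.
rewrite (exprD _ 3 1) yV3 expr1 -mulrA -expr2 mulrA -exprSr.
by congr (_ ^+ _ * _); lia.
Qed.

End FrobeniusAlgebra.

(** * Classes and commutation around a face *)

Section Classes.
Variable (T : finType).
Implicit Types (r : rel T) (x y a b : T).

Definition class_of r x : {set T} := [set y | r x y].
Definition classes r : {set {set T}} := [set class_of r x | x : T].
Definition other_classes r a b := [set C in classes r | (a \notin C) && (b \notin C)].

Lemma mem_class_of r x y : (y \in class_of r x) = r x y.
Proof. by rewrite inE. Qed.

Lemma eq_class_of r r' x : r =2 r' -> class_of r x = class_of r' x.
Proof. by move=> E; apply/setP => y; rewrite !inE E. Qed.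

Lemma eq_classes r r' : r =2 r' -> classes r = classes r'.
Proof. by move=> E; apply: eq_imset => x; apply: eq_class_of. Qed.

Lemma eq_other_classes r r' a b : r =2 r' -> other_classes r a b = other_classes r' a b.
Proof. by move=> E; rewrite /other_classes (eq_classes E). Qed.

Lemma class_of_eq r x y : eqv r -> (class_of r x == class_of r y) = r x y.
Proof.
move=> re; have [rr _ _] := re; apply/eqP/idP => [E|xy].
  by rewrite -mem_class_of E inE rr.
by apply/setP => z; rewrite !inE (eqv_left z re xy).
Qed.

Lemma classes_split r a b : eqv r ->
  classes r = class_of r a |: (class_of r b |: other_classes r a b).
Proof.
move=> re; have [rr rs _] := re; apply/setP => C; rewrite !inE.
apply/idP/idP => [CC|/or3P [/eqP ->|/eqP ->|/andP []//]]; try exact: imset_f.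
rewrite CC /=; case/imsetP: CC => x _ ->; rewrite !class_of_eq // !inE.
by case: (r x a); case: (r x b).
Qed.

Lemma other_classesP r a b C : eqv r -> reflect
  (exists x, [/\ C = class_of r x, ~~ r x a & ~~ r x b]) (C \in other_classes r a b).
Proof.
move=> re; rewrite inE; apply: (iffP idP) => [/andP [/imsetP [x _ ->]]|[x [-> xa xb]]].
  by rewrite !inE => /andP [xa xb]; exists x.
by rewrite imset_f // !inE xa xb.
Qed.

Lemma other_classes_join r a b : eqv r -> eqv (join_rel r a b) ->
  other_classes (join_rel r a b) a b = other_classes r a b.
Proof.
move=> re je; have [rr rs _] := re.
have E x : ~~ r x a -> ~~ r x b -> class_of (join_rel r a b) x = class_of r x.
  move=> /negbTE xa /negbTE xb; apply/setP => y.
  by rewrite !inE /join_rel xa xb !orbF.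
apply/setP => C; apply/other_classesP/other_classesP => // -[x [-> xa xb]]; exists x.
  move: xa xb; rewrite /join_rel !rr !andbT !negb_or.
  by move=> /and3P [xa _ xb] _; rewrite -E.
by rewrite E // /join_rel (negbTE xa) (negbTE xb).
Qed.

Lemma class_of_join r a b : eqv r ->
  class_of (join_rel r a b) a = class_of r a :|: class_of r b.
Proof.
move=> re; have [rr rs _] := re; apply/setP => y; rewrite !inE /join_rel rr /=.
by case: (r a y) (r b y) (r a b) => [] [] [].
Qed.

Lemma card_classes r a b : eqv r ->
  #|classes r| = (#|other_classes r a b| + if r a b then 1 else 2)%N.
Proof.
move=> re; have [rr rs _] := re; rewrite (classes_split a b re) !cardsU1 !inE.
rewrite class_of_eq // rr !andbF !orbF.
by rewrite rr !andbF; case: (r a b); lia.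
Qed.

(** Both sides are 2 plus the number of classes avoiding [a] and [b]. Combined over the four sides
    of a face, these equations exclude inconsistent sequences of merges, splits and single-circle
    changes. *)
Lemma card_classes_change r r' a b : eqv r -> eqv r' -> smoothing_change r r' a b ->
  (#|classes r| + r a b = #|classes r'| + r' a b)%N.
Proof.
have J s s' : eqv s -> eqv s' -> ~~ s a b -> s' =2 join_rel s a b ->
    #|classes s| = (#|classes s'|.+1)%N /\ s' a b.
  move=> se se' ab E; have je : eqv (join_rel s a b) := eqv_eq E se'.
  rewrite (card_classes a b se) (card_classes a b se') (eq_other_classes _ _ E).
  by rewrite other_classes_join // E join_relE // (negbTE ab) addn1 addn2.
move=> re re' [ab E|ab E|ab E].
- by have [-> ->] := J _ _ re re' ab E; rewrite (negbTE ab); lia.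
- by rewrite (eq_classes E) E.
- by have [-> ->] := J _ _ re' re ab E; rewrite (negbTE ab); lia.
Qed.

End Classes.

Section Face.
Variables (n : nat) (n_gt0 : (0 < n)%N) (X : finType).
Local Notation R := (Zinv n).
Local Notation W := {ffun X -> V n}.
Implicit Types (r : rel X) (w : W) (F : W -> R).

(* A function w : X -> V stands for a pure tensor in the tensor power of V over X. *)
Definition mul_at w x (u : V n) : W := [ffun y => if y == x then w y * u else w y].

Lemma mul_atC w x y u v : mul_at (mul_at w x u) y v = mul_at (mul_at w y v) x u.
Proof.
apply/ffunP => z; rewrite !ffunE; case: (z == x); case: (z == y) => //.
exact: mulrAC.
Qed.

Lemma mul_atM w x u v : mul_at (mul_at w x u) x v = mul_at w x (u * v).
Proof. by apply/ffunP => z; rewrite !ffunE; case: (z == x) => //; rewrite mulrA. Qed.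

(* F is a linear form on the tensor power of V over X, factoring through the
   quotient in which r-related copies of V are identified. *)
Definition tensor_form r F := [/\ forall w x y u, r x y -> F (mul_at w x u) = F (mul_at w y u),
  forall w x u v, F (mul_at w x (u + v)) = F (mul_at w x u) + F (mul_at w x v) &
  forall w x c u, F (mul_at w x (iota c * u)) = c * F (mul_at w x u)].

(** Inserts the copairing, the sum of dual tensor basis, at [a] and [b]. *)
Definition comul_at a b F w : R :=
  \sum_p F (mul_at (mul_at w a (dualV p)) b (monoV p)).

(* Adjoint of the map attached to the change of smoothing [r] -> [r'] *)
Definition smoothing_op r r' a b F w : R :=
  if r a b then if r' a b then F (mul_at w a (theta n)) else F w
  else comul_at a b F w.

Lemma dualV_expand (u : V n) : u = \sum_p iota (eps n_gt0 (u * monoV p)) * dualV p.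
Proof.
apply: (coefV_inj n_gt0) => q; rewrite -!(eps_dualV n_gt0) big_distrl eps_sum /=.
rewrite [u * _]mulrC -(eps_dualV_sum n_gt0); apply: eq_bigr => p _.
by rewrite -mulrA eps_iota mulrC (mulrC u) (mulrC (dualV p)).
Qed.

Lemma monoV_expand_eps (u : V n) : u = \sum_p iota (eps n_gt0 (u * dualV p)) * monoV p.
Proof.
by rewrite {1}(monoV_expand n_gt0 u); apply: eq_bigr => p _; rewrite eps_dualV.
Qed.

Lemma tensor_form_sum r F (I : Type) (s : seq I) (P : pred I) (u : I ->
  V n) w x : tensor_form r F ->
  F (mul_at w x (\sum_(i <- s | P i) u i)) = \sum_(i <- s | P i) F (mul_at w x (u i)).
Proof.
case=> _ FD Fc; apply: (big_morph (fun u => F (mul_at w x u)) (FD w x)).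
by have := Fc w x 0 0; rewrite mulr0 mul0r.
Qed.

Lemma comul_at_same r F a b w : tensor_form r F -> r a b ->
  comul_at a b F w = F (mul_at (mul_at w a (theta n)) a (theta n)).
Proof.
move=> TF ab; have [Fr _ _] := TF.
rewrite mul_atM theta2 // (tensor_form_sum _ _ _ _ _ TF); apply: eq_bigr => p _.
by rewrite -mul_atM (Fr _ _ _ _ ab).
Qed.

Lemma tensor_form_scale r F (I : finType) (c : I -> R) (v : I -> V n) w x : tensor_form r F ->
  F (mul_at w x (\sum_i iota (c i) * v i)) = \sum_i c i * F (mul_at w x (v i)).
Proof.
move=> TF; rewrite (tensor_form_sum _ _ _ _ _ TF); have [_ _ Fc] := TF.
by apply: eq_bigr => i _; rewrite Fc.
Qed.

(** A factor may pass from one leg of the copairing to the other: expanding in the dual basis on one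
    leg and in the monomials on the other gives the same coefficients [eps] of u times dual times
    monomial. *)
Lemma comul_at_slide r F a b w u : tensor_form r F ->
  comul_at a b F (mul_at w a u) = comul_at a b F (mul_at w b u).
Proof.
move=> TF; rewrite /comul_at.
under eq_bigr => p _ do rewrite mul_atM mul_atC (dualV_expand (u * _))
  (tensor_form_scale _ _ _ _ TF).
under [RHS]eq_bigr => p _ do
  rewrite (mul_atC w b) mul_atM (monoV_expand_eps (u * _)) (tensor_form_scale _ _ _ _ TF).
rewrite exchange_big; apply: eq_bigr => p _; apply: eq_bigr => q _.
by rewrite (mulrAC u) (mul_atC w b).
Qed.

Lemma comul_atC r F a b w : tensor_form r F -> comul_at a b F w = comul_at b a F w.
Proof.
move=> TF; rewrite /comul_at.
under eq_bigr => p _ do rewrite mul_atC (monoV_expand_eps (dualV _)) (tensor_form_scale _ _ _ _ TF).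
under [RHS]eq_bigr => p _ do rewrite mul_atC (monoV_expand_eps (dualV _))
  (tensor_form_scale _ _ _ _ TF).
rewrite exchange_big; apply: eq_bigr => p _; apply: eq_bigr => q _.
by rewrite (mulrC (dualV q)) (mul_atC w b).
Qed.

Lemma comul_at_mul F a b c u w :
  comul_at a b (fun w => F (mul_at w c u)) w = comul_at a b F (mul_at w c u).
Proof. by apply: eq_bigr => p _; rewrite (mul_atC w c) (mul_atC _ c). Qed.

Lemma comul_at_comm F a b c d w : comul_at a b (comul_at c d F) w = comul_at c d (comul_at a b F) w.
Proof.
rewrite /comul_at exchange_big; apply: eq_bigr => p _; apply: eq_bigr => q _.
by rewrite (mul_atC _ b c) (mul_atC _ a c) (mul_atC _ b d) (mul_atC _ a d).
Qed.

Lemma comul_at_class r F a b c d w : tensor_form r F -> r a c -> r b d ->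
  comul_at a b F w = comul_at c d F w.
Proof.
move=> TF ac bd; have [Fr _ _] := TF; apply: eq_bigr => p _.
by rewrite (Fr _ _ _ _ bd) mul_atC (Fr _ _ _ _ ac) mul_atC.
Qed.

Lemma comul_at_mul_class r F a b x y w u : tensor_form r F -> r x y ->
  comul_at a b F (mul_at w x u) = comul_at a b F (mul_at w y u).
Proof.
move=> TF xy; have [Fr _ _] := TF; rewrite -!comul_at_mul; apply: eq_bigr => p _.
exact: Fr.
Qed.

Lemma join_rel_sub T (r : rel T) a b x y : r x y -> join_rel r a b x y.
Proof. by rewrite /join_rel => ->. Qed.

Lemma merging_change r r' a b : smoothing_change r r' a b -> eqv r' ->
  r a b = false -> r' =2 join_rel r a b.
Proof. by case=> [_ // | -> // | _ E re']; rewrite E join_relE. Qed.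

Lemma nonmerging_change r r' a b : smoothing_change r r' a b ->
  r a b -> if r' a b then r' =2 r else r =2 join_rel r' a b.
Proof.
by case=> [/negbTE nab _ | ab E _ | /negbTE nab E _]; rewrite ?nab // E ab.
Qed.

Lemma nonmerging_sub r r' a b x y : smoothing_change r r' a b ->
  r a b -> r' x y -> r x y.
Proof.
move=> h ab; have := nonmerging_change h ab.
by case: ifP => _ E; rewrite E //; apply: join_rel_sub.
Qed.

(** One change merges and the other does not. The merge persists on the opposite side because [r01]
    refines [r00]; the other operator is theta or the identity, both of which commute with inserting
    the copairing. *)
Lemma face_commute_merge r00 r10 r01 r11 a b c d F w :
  eqv r00 -> eqv r10 -> eqv r01 -> eqv r11 ->
  smoothing_change r00 r10 a b -> smoothing_change r10 r11 c d ->
  smoothing_change r00 r01 c d -> smoothing_change r01 r11 a b ->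
  r00 a b = false -> r00 c d ->
  smoothing_op r10 r11 c d (smoothing_op r00 r10 a b F) w =
  smoothing_op r01 r11 a b (smoothing_op r00 r01 c d F) w.
Proof.
move=> e00 e10 e01 e11 h1 h2 h3 h4 ab0 cd0.
have cd1 : r10 c d by rewrite (merging_change h1) // join_rel_sub.
have ab1 : r01 a b = false.
  by apply/negP => /(nonmerging_sub h3 cd0); rewrite ab0.
have ab10 : r10 a b by rewrite (merging_change h1) // join_relE.
have ab11 : r11 a b by rewrite (merging_change h4) // join_relE.
have := card_classes_change e00 e10 h1; have := card_classes_change e10 e11 h2.
have := card_classes_change e00 e01 h3; have := card_classes_change e01 e11 h4.
rewrite /smoothing_op ab0 cd0 cd1 ab1 ab10 ab11 => k4 k3 k2 k1.
have -> : r11 c d = r01 c d by move: k1 k2 k3 k4; case: (r11 c d); case: (r01 c d) => /=; lia.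
by case: (r01 c d) => //; rewrite comul_at_mul.
Qed.

(** Two merges commute as insertions unless they join the same two circles; then the second change
    acts by 1 or theta, and a theta slides along the copairing. If neither change merges at [r00],
    each route gives a power of theta, a split followed by a merge giving theta^2. The count shows
    that the powers agree, and linking of the two edges moves a theta from one to the other. *)
Lemma face_commute r00 r10 r01 r11 a b c d F w :
  eqv r00 -> eqv r10 -> eqv r01 -> eqv r11 ->
  smoothing_change r00 r10 a b -> smoothing_change r10 r11 c d ->
  smoothing_change r00 r01 c d -> smoothing_change r01 r11 a b ->
  tensor_form r00 F ->
  smoothing_op r10 r11 c d (smoothing_op r00 r10 a b F) w =
  smoothing_op r01 r11 a b (smoothing_op r00 r01 c d F) w.
Proof.
move=> e00 e10 e01 e11 h1 h2 h3 h4 TF.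
case ab0: (r00 a b); case cd0: (r00 c d); last first.
- have E1 := merging_change h1 e10 ab0; have E3 := merging_change h3 e01 cd0.
  have [Fr _ _] := TF; have [rr rs rt] := e00.
  have ab10 : r10 a b by rewrite E1 join_relE.
  have cd01 : r01 c d by rewrite E3 join_relE.
  have cd10 : r10 c d = r01 a b.
    rewrite E1 E3 /join_rel ab0 cd0 /= (rs c a) (rs b d) (rs c b).
    by rewrite [r00 b c && _]andbC.
  have k1 := card_classes_change e00 e10 h1; have k2 := card_classes_change e10 e11 h2.
  have k3 := card_classes_change e00 e01 h3; have k4 := card_classes_change e01 e11 h4.
  rewrite /smoothing_op ab0 cd0 cd10; case: ifP => ab1; last exact: comul_at_comm.
  rewrite ab0 ab10 cd0 cd01 cd10 ab1 in k1 k2 k3 k4.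
  have -> : r11 c d = r11 a b by move: k1 k2 k3 k4; case: (r11 c d); case: (r11 a b) => /=; lia.
  have [ECD ca] : comul_at a b F =1 comul_at c d F /\ (r00 c a \/ r00 c b).
    move: ab1; rewrite E3 /join_rel ab0 /= => /orP [] /andP [ac bd].
      split; last by left; rewrite rs.
      by move=> u; apply: comul_at_class TF _ _; rewrite // rs.
    split; last by right.
    by move=> u; rewrite (comul_atC a b u TF); apply: comul_at_class TF _ _; rewrite // rs.
  case: (r11 a b) => //; rewrite -!ECD; case: ca => ca.
    exact: comul_at_mul_class TF ca.
  by rewrite (comul_at_mul_class a b w _ TF ca) (comul_at_slide a b w _ TF).
- by apply: face_commute_merge.
- by apply/esym/face_commute_merge.
have [Fr _ _] := TF; have [rr rs rt] := e00.
have E1 := nonmerging_change h1 ab0; have E3 := nonmerging_change h3 cd0.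
have k1 := card_classes_change e00 e10 h1; have k2 := card_classes_change e10 e11 h2.
have k3 := card_classes_change e00 e01 h3; have k4 := card_classes_change e01 e11 h4.
have sub1 := nonmerging_sub h1 ab0; have sub3 := nonmerging_sub h3 cd0.
(* If joining [c] to [d] is what connects [a] with [b], then [a] already shares a class of [r00]
   with [c]. *)
have link r r' : r' =2 join_rel r c d -> (forall x y, r x y -> r00 x y) ->
    r' a b -> r a b = false -> r00 a c.
  move=> E sub; rewrite E => /orP [-> //|/orP [] /andP [/sub h _]] _ //.
  by apply: rt h _; rewrite rs.
have link' r r' : r' =2 join_rel r a b -> (forall x y, r x y -> r00 x y) ->
    r' c d -> r c d = false -> r00 c a.
  move=> E sub; rewrite E => /orP [-> //|/orP [] /andP [/sub h _]] _ //.
  by apply: rt h _; rewrite rs.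
rewrite /smoothing_op ab0 cd0; rewrite ab0 cd0 in k1 k3.
case cd10: (r10 c d); case ab01: (r01 a b); rewrite ?cd10 ?ab01 in k2 k4 E1 E3.
- have h2' := nonmerging_change h2 cd10; have h4' := nonmerging_change h4 ab01.
  (* Both routes carry the same number of factors theta; only their positions can differ. *)
  have k : (r10 a b + r11 c d = r01 c d + r11 a b)%N by move: k1 k2 k3 k4 => /=; lia.
  case ab10: (r10 a b) E1 k; case cd11: (r11 c d) h2'; case cd01: (r01 c d) E3;
    case ab11: (r11 a b) h4' => E4 E3 E2 E1 // _; try by rewrite mul_atC.
  + by apply: Fr; apply: (link _ _ E2); rewrite ?E1 // => x y h; rewrite -E1 E2 join_rel_sub.
  + by have := E2 a b; rewrite ab10 ab11.
- have cd01 : r01 c d = false.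
    by apply/negP => cd01; move: E3; rewrite cd01 => /(_ a b); rewrite ab01 ab0.
  rewrite cd01 in E3 k3.
  have ab11 : r11 a b by rewrite (merging_change h4) // join_relE.
  have [-> ->] : r11 c d /\ r10 a b.
    by move: k1 k2 k3 k4; rewrite ab11; case: (r11 c d); case: (r10 a b) => /=; lia.
  (* Through [r01] a circle splits and is merged again, which inserts theta^2; through [r10] theta
     is inserted twice. *)
  rewrite cd01 (comul_at_same _ TF) // mul_atC; apply: Fr; rewrite rs.
  by apply: (link _ _ E3).
- have ab10 : r10 a b = false.
    by apply/negP => ab10; move: E1; rewrite ab10 => /(_ c d); rewrite cd10 cd0.
  rewrite ab10 in E1 k1.
  have cd11 : r11 c d by rewrite (merging_change h2) // join_relE.
  have [-> ->] : r11 a b /\ r01 c d.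
    by move: k1 k2 k3 k4; rewrite cd11; case: (r11 a b); case: (r01 c d) => /=; lia.
  rewrite ab10 (comul_at_same _ TF) // [in RHS]mul_atC; apply: Fr.
  by apply: (link' _ _ E1).
- have ab10 : r10 a b = false.
    by apply/negP => ab10; move: E1; rewrite ab10 => /(_ c d); rewrite cd10 cd0.
  have cd01 : r01 c d = false.
    by apply/negP => cd01; move: E3; rewrite cd01 => /(_ a b); rewrite ab01 ab0.
  rewrite ab10 cd01 !(comul_at_same _ TF) //.
  rewrite cd01 in E3.
  have ac : r00 c a.
    by rewrite rs; apply: (link _ _ E3).
  by rewrite !mul_atM; apply: Fr.
Qed.

End Face.

(** * Pairing of chains with tensors *)

Section Pairing.
Variables (n : nat) (n_gt0 : (0 < n)%N) (G : tpmgraph).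
Local Notation R := (Zinv n).
Local Notation X := (strand_half G).
Local Notation W := {ffun X -> V n}.
Local Notation eps := (eps n_gt0).
Implicit Types (al : state G) (i : 'I_(ell G)) (x y : X) (w : W) (C : {set X}).

Definition conn al : rel X := connect (strand al).

Lemma strand_sym al : symmetric (strand al).
Proof.
move=> x y; rewrite /strand; congr (_ || _); last exact: orbC.
by rewrite -(inj_eq (can_inj (@oppK G))) oppK eq_sym.
Qed.

Lemma conn_eqv al : eqv (conn al).
Proof. exact/eqv_connect/strand_sym. Qed.

Lemma circlesE al : circles al = classes (conn al).
Proof. by []. Qed.

Lemma mem_circle_set al x y : (y \in circle_set al x) = conn al x y.
Proof. by rewrite inE. Qed.

Lemma circle_set_eq al x y : (circle_set al x == circle_set al y) = conn al x y.
Proof. exact: class_of_eq (conn_eqv al). Qed.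

Section Extension.
Variables (al : state G) (f : {ffun circle al -> mono n}).

(** Colours are extended to all sets of half-edges, by the monomial 1 off the circles, so that
    colourings of different states can be compared on a common set. *)
Definition color C : mono n :=
  if insub C is Some c then f c else (Ordinal n_gt0, ord0).

Lemma color_val (c : circle al) : color (val c) = f c.
Proof. by rewrite /color valK. Qed.

Lemma color_at x : color (circle_set al x) = f (circle_at al x).
Proof. by rewrite -color_val. Qed.

Definition wprod w C : V n := \prod_(x in C) w x.

Definition circle_eval w C : R := eps (monoV (color C) * wprod w C).

Definition state_eval w : R := \prod_(C in circles al) circle_eval w C.

End Extension.

Lemma wprod_mul_at w x u C :
  wprod (mul_at w x u) C = wprod w C * (if x \in C then u else 1).
Proof.
rewrite /wprod; case: ifP => xC; last first.
  rewrite mulr1; apply: eq_bigr => y yC; rewrite ffunE.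
  by case: eqP => // yx; rewrite -yx yC in xC.
rewrite (bigD1 x) //= (bigD1 x (P := mem C)) //= ffunE eqxx mulrAC; congr (_ * _ * _).
by apply: eq_bigr => y /andP [_ /negbTE yx]; rewrite ffunE yx.
Qed.

Lemma circle_eval_mul_at al (f : {ffun circle al -> mono n}) w x u C :
  circle_eval f (mul_at w x u) C =
  if x \in C then eps (monoV (color f C) * wprod w C * u) else circle_eval f w C.
Proof.
by rewrite /circle_eval wprod_mul_at; case: ifP => _; rewrite ?mulr1 // mulrA.
Qed.

Lemma state_evalD1 al (f : {ffun circle al -> mono n}) w x u :
  state_eval f (mul_at w x u) =
  eps (monoV (color f (circle_set al x)) * wprod w (circle_set al x) * u) *
  \prod_(C in circles al :\ circle_set al x) circle_eval f w C.
Proof.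
have re := conn_eqv al; have [rr rs rt] := re.
rewrite /state_eval (big_setD1 (circle_set al x)) ?circle_set_in //=.
rewrite circle_eval_mul_at mem_circle_set rr; congr (_ * _); apply: eq_bigr => C.
rewrite circle_eval_mul_at in_setD1 => /andP [N /imsetP [y _ CE]].
by case: ifP => //; rewrite CE mem_circle_set -circle_set_eq -CE (negbTE N).
Qed.

Lemma state_eval_tensor_form al (f : {ffun circle al -> mono n}) :
  tensor_form (conn al) (state_eval f).
Proof.
have re := conn_eqv al; split=> [w x y u xy|w x u v|w x c u]; rewrite !state_evalD1.
- by rewrite (eqP (_ : circle_set al x == circle_set al y)) // circle_set_eq.
- by rewrite mulrDr epsD mulrDl.
- by rewrite mulrCA eps_iota mulrA.
Qed.

(** [pick] depends only on the set, so it singles out one half-edge on each circle; that one carries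
    the dual of the colour and all others carry 1. Pairing with this tensor reads off the
    coefficient of [f], so the tensors separate chains. *)
Definition transversal_weight al (f : {ffun circle al -> mono n}) : W :=
  [ffun x => if [pick y in circle_set al x] == Some x
             then dualV (color f (circle_set al x)) else 1].

Lemma wprod_transversal al (f : {ffun circle al -> mono n}) C : C \in circles al ->
  wprod (transversal_weight f) C = dualV (color f C).
Proof.
have re := conn_eqv al; have [rr rs rt] := re.
move=> CC; have CE y : y \in C -> circle_set al y = C.
  by case/imsetP: CC => x _ ->; rewrite mem_circle_set => xy; apply/esym/eqP; rewrite circle_set_eq.
rewrite /wprod; case xP: [pick y in C] => [x|]; move: (xP); case: pickP => // z zC.
  case=> zx; rewrite zx /= in zC.
  rewrite (bigD1 x) //= ffunE CE // xP eqxx big1 ?mulr1 // => y /andP [yC yx].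
  by rewrite ffunE CE // xP; case: eqP => // -[E]; rewrite E eqxx in yx.
by case/imsetP: CC => x _ E; have := z x; rewrite /= E mem_circle_set rr.
Qed.

Lemma state_eval_transversal al (f g : {ffun circle al -> mono n}) :
  state_eval g (transversal_weight f) = (g == f)%:R.
Proof.
rewrite /state_eval; under eq_bigr => C CC do
  rewrite /circle_eval wprod_transversal // eps_dualV coefV_mono //.
case: eqP => [->|ne]; first by rewrite big1 // => C _; rewrite eqxx.
have [c cP] : exists c, g c != f c.
  by apply/existsP; apply: contra_notT ne; rewrite negb_exists => /forallP E;
    apply/ffunP => c; apply/eqP; have := E c; rewrite negbK.
by rewrite (big_setD1 (val c)) ?(valP c) //= !color_val (negbTE cP) mul0r.
Qed.

Definition chain_eval (v : chain n G) al w : R :=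
  \sum_(f : {ffun circle al -> mono n}) v (existT _ al f) * state_eval f w.

Lemma chain_eval_eq0 (v : chain n G) : (forall al w, chain_eval v al w = 0) -> v = 0.
Proof.
move=> v0; apply/ffunP => -[al f]; rewrite ffunE.
rewrite -[RHS](v0 al (transversal_weight f)) /chain_eval (bigD1 f) //=.
rewrite state_eval_transversal eqxx mulr1 big1 ?addr0 // => g /negbTE gf.
by rewrite state_eval_transversal gf mulr0.
Qed.

End Pairing.

(** * Adjoints of the edge maps *)

Section Adjunction.
Variables (n : nat) (n_gt0 : (0 < n)%N) (G : tpmgraph).
Local Notation R := (Zinv n).
Local Notation X := (strand_half G).
Local Notation W := {ffun X -> V n}.
Local Notation eps := (eps n_gt0).
Local Notation color := (color n_gt0).
Local Notation circle_eval := (circle_eval n_gt0).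
Local Notation state_eval := (state_eval n_gt0).
Implicit Types (al : state G) (i : 'I_(ell G)) (x y : X) (w : W) (C : {set X}).

Lemma eps_mulV_sum (v w : V n) : \sum_p coefV v p * eps (monoV p * w) = eps (v * w).
Proof.
by rewrite -eps_dualV_sum; apply: eq_bigr => p _; rewrite eps_dualV.
Qed.

(** The adjoint of Delta is multiplication, so pairing after a split is pairing with the product
    over the undivided circle. *)
Lemma eps_Delta_sum (v u w : V n) :
  \sum_p \sum_q DeltaV v (p, q) * (eps (monoV p * u) * eps (monoV q * w)) = eps (v * (u * w)).
Proof.
transitivity (\sum_p eps (v * w * dualV p) * eps (monoV p * u)).
  apply: eq_bigr => p _; transitivity (eps (v * dualV p * w) * eps (monoV p * u)).
    rewrite -(eps_dualV_sum n_gt0 (v * dualV p) w) big_distrl; apply: eq_bigr => q _ /=.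
    by rewrite (DeltaVE n_gt0) -[RHS]mulrA [eps (monoV p * u) * _]mulrC.
  by rewrite (mulrAC v).
by rewrite eps_dualV_sum [u * w]mulrC mulrA.
Qed.

Lemma circle_at_eq al x y : (circle_at al x == circle_at al y) = conn al x y.
Proof. by rewrite -circle_set_eq -val_eqE. Qed.

Section Recolor.
Variables (al' : state G) (col : {set X} -> mono n) (a b : X).
Local Notation r' := (conn al').
Local Notation F' := {ffun circle al' -> mono n}.

Definition agrees (f : F') := [forall C in other_classes r' a b, color f C == col C].

Definition recolor (p q : mono n) : F' :=
  [ffun c => if val c == circle_set al' a then p else
             if val c == circle_set al' b then q else col (val c)].

Lemma recolor_agrees p q : agrees (recolor p q).
Proof.
apply/forall_inP => C CC; move: (CC); rewrite inE => /and3P [CC' aC bC].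
have -> : color (recolor p q) C = recolor p q (exist _ C CC') by rewrite -(color_val n_gt0).
have [rr _ _] := conn_eqv al'.
rewrite ffunE /=; case: (C =P circle_set al' a) => [e|_].
  by rewrite e mem_circle_set rr in aC.
by case: (C =P circle_set al' b) => [e|_ //]; rewrite e mem_circle_set rr in bC.
Qed.

(** A colouring prescribed off the affected circle amounts to one free monomial there, so the sum
    over target generators becomes a sum over the basis of V. *)
Lemma sum_agrees_same (H : mono n -> R) : r' a b ->
  \sum_(f | agrees f) H (f (circle_at al' a)) = \sum_p H p.
Proof.
move=> ab; have [rr _ _] := conn_eqv al'.
rewrite (reindex_onto (fun p => recolor p p) (fun f : F' => f (circle_at al' a))) /=.
  by apply: eq_big => [p|p _]; rewrite ?recolor_agrees ffunE /= !eqxx.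
move=> f /forall_inP fa; apply/ffunP => c; rewrite ffunE.
have : val c \in classes r' := valP c.
rewrite (classes_split a b (conn_eqv al')) !in_setU1 => /or3P cP;
  case: (val c =P circle_set al' a) => [e|na] /=.
  by congr (f _); apply: val_inj; rewrite e.
case: (val c =P circle_set al' b) => [e|nb] /=.
  by congr (f _); apply: val_inj; rewrite e; apply/eqP; rewrite circle_set_eq.
by case: cP => [/eqP //|/eqP //|cU]; rewrite -(color_val n_gt0 f); apply/esym/eqP/fa.
Qed.

Lemma sum_agrees_diff (H : mono n -> mono n -> R) : ~~ r' a b ->
  \sum_(f | agrees f) H (f (circle_at al' a)) (f (circle_at al' b)) = \sum_p \sum_q H p q.
Proof.
move=> ab; have [rr _ _] := conn_eqv al'; rewrite pair_big /=.
have ba : (circle_set al' b == circle_set al' a) = false.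
  by rewrite eq_sym circle_set_eq (negbTE ab).
rewrite (reindex_onto (fun p => recolor p.1 p.2)
   (fun f : F' => (f (circle_at al' a), f (circle_at al' b)))) /=.
  by apply: eq_big => [p|p _]; rewrite ?recolor_agrees !ffunE /= !eqxx ba //
    -surjective_pairing eqxx.
move=> f /forall_inP fa; apply/ffunP => c; rewrite ffunE /=.
have : val c \in classes r' := valP c.
rewrite (classes_split a b (conn_eqv al')) !in_setU1 => /or3P cP;
  case: (val c =P circle_set al' a) => [e|na] /=.
  by congr (f _); apply: val_inj; rewrite e.
case: (val c =P circle_set al' b) => [e|nb] /=.
  by congr (f _); apply: val_inj; rewrite e.
by case: cP => [/eqP //|/eqP //|cU]; rewrite -(color_val n_gt0 f); apply/esym/eqP/fa.
Qed.

End Recolor.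

Lemma state_eval_split al (f : {ffun circle al -> mono n}) a b w :
  state_eval f w =
  (if conn al a b then circle_eval f w (circle_set al a)
   else circle_eval f w (circle_set al a) * circle_eval f w (circle_set al b)) *
  \prod_(C in other_classes (conn al) a b) circle_eval f w C.
Proof.
have [rr _ _] := conn_eqv al.
rewrite /state_eval circlesE (classes_split a b (conn_eqv al)).
have bO : class_of (conn al) b \notin other_classes (conn al) a b by rewrite !inE rr !andbF.
have aO : class_of (conn al) a \notin other_classes (conn al) a b by rewrite !inE rr !andbF.
case: ifP => ab.
  have /eqP <- : class_of (conn al) a == class_of (conn al) b by rewrite (class_of_eq _ _
    (conn_eqv al)).
  by rewrite setUA setUid big_setU1.
rewrite big_setU1 /=; last first.
  by rewrite in_setU1 (negbTE aO) (class_of_eq _ _ (conn_eqv al)) ab.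
by rewrite big_setU1 //= mulrA.
Qed.

Lemma wprod_setU al a b w : ~~ conn al a b ->
  wprod w (circle_set al a :|: circle_set al b) = wprod w (circle_set al a) * wprod w
    (circle_set al b).
Proof.
move=> ab; rewrite /wprod -bigU; last first.
  have [_ rs rt] := conn_eqv al; apply/pred0P => x /=; rewrite !mem_circle_set.
  by apply: contraNF ab => /andP [ax]; rewrite rs; apply: rt.
by apply: eq_bigl => x; rewrite inE.
Qed.

Lemma mul_at1 w x : mul_at w x 1 = w.
Proof. by apply/ffunP => y; rewrite ffunE mulr1 if_same. Qed.

Section EdgeMap.
Variables (al : state G) (i : 'I_(ell G)).
Hypothesis ai : al i = false.
Let al' := set_state al i true.
Let a := UL i.
Let b := UR i.
Variable f : {ffun circle al -> mono n}.

(** Joining the classes of [a] and [b] alters no class avoiding both. *)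
Lemma other_circles : other_classes (conn al') a b = other_classes (conn al) a b.
Proof.
have := smoothing_changeP ai; rewrite -/(conn al) -/al' -/(conn al') -/a -/b.
case=> [_ E|_ E|_ E]; rewrite (eq_other_classes _ _ E) // other_classes_join //;
  first [exact: conn_eqv | exact: eqv_eq E (conn_eqv _)].
Qed.

Lemma unaffectedE (f' : {ffun circle al' -> mono n}) :
  [forall c : circle al, forall c' : circle al',
      (val c == val c') && (UL i \notin val c) && (UR i \notin val c)
      ==> (f c == f' c')] = agrees (color f) a b f'.
Proof.
apply/forallP/forall_inP => [H C CU|H c].
  move: (CU); rewrite inE => /and3P [C' aC bC].
  move: (CU); rewrite other_circles inE => /andP [C0 _].
  have /forallP /(_ (exist _ C C')) /implyP := H (exist _ C C0).
  by rewrite /= eqxx aC bC -!(color_val n_gt0) /= eq_sym; apply.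
apply/forallP => c'; apply/implyP => /andP [/andP [/eqP cc ac] bc].
rewrite -!(color_val n_gt0) cc eq_sym; apply: H.
by rewrite -cc inE ac bc cc -circlesE (valP c').
Qed.

Lemma edge_map_adjoint w :
  \sum_(f' : {ffun circle al' -> mono n})
     edge_coef i (existT _ al f) (existT _ al' f') * state_eval f' w =
  smoothing_op (conn al) (conn al') a b (state_eval f) w.
Proof.
(* The unaffected circles are the same sets with the same colours in both states, so their common
   factor [K] comes out and a local identity in V remains. *)
set K := \prod_(C in other_classes (conn al) a b) circle_eval f w C.
transitivity (K * \sum_(f' | agrees (color f) a b f')
   (if conn al a b then
      if conn al' a b then coefV (mV (monoV (f (circle_at al a)))) (f' (circle_at al' a))
      else DeltaV (monoV (f (circle_at al a))) (f' (circle_at al' a), f' (circle_at al' b))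
    else coefV (monoV (f (circle_at al a)) * monoV (f (circle_at al b))) (f' (circle_at al' a))) *
   (if conn al' a b then eps (monoV (f' (circle_at al' a)) * wprod w (circle_set al' a))
    else eps (monoV (f' (circle_at al' a)) * wprod w (circle_set al' a))
       * eps (monoV (f' (circle_at al' b)) * wprod w (circle_set al' b)))).
  rewrite big_distrr /= [RHS]big_mkcond /=; apply: eq_bigr => f' _.
  rewrite /edge_coef /= unaffectedE; case fa: (agrees _ _ _ f'); last by rewrite mulr0n !mul0r.
  rewrite mulr1n mul1r (state_eval_split f' a b) !circle_at_eq.
  rewrite other_circles (_ : \prod_(C in _) circle_eval f' w C = K); last first.
    apply: eq_bigr => C; rewrite -other_circles => CU.
    by move/forall_inP: fa => /(_ C CU) /eqP e; rewrite /circle_eval e.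
  by rewrite /circle_eval !color_at mulrA mulrC.
have h := smoothing_changeP ai; rewrite -/(conn al) -/al' -/(conn al') -/a -/b in h.
have KE u v x y : (x = a \/ x = b) -> (y = a \/ y = b) ->
    \prod_(C in other_classes (conn al) a b) circle_eval f (mul_at (mul_at w x u) y v) C = K.
  move=> xab yab; apply: eq_bigr => C; rewrite inE => /and3P [_ aC bC].
  rewrite !circle_eval_mul_at.
  by case: yab => ->; case: xab => ->; rewrite ?(negbTE aC) ?(negbTE bC).
have [rr _ _] := conn_eqv al; rewrite /smoothing_op.
case ab: (conn al a b).
- have := nonmerging_change h ab; case ab': (conn al' a b) => E.
  + rewrite (sum_agrees_same _ (fun p => coefV (mV (monoV (f (circle_at al a)))) p * eps
      (monoV p * wprod w (circle_set al' a)))) //.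
    rewrite eps_mulV_sum mVE (_ : circle_set al' a = circle_set al a); last exact: eq_class_of.
    rewrite (state_eval_split f a b) ab mulrC; congr (_ * _); last first.
      by rewrite -[mul_at _ _ _](mul_at1 _ a) KE //; left.
    by rewrite circle_eval_mul_at mem_circle_set rr color_at mulrAC.
  + rewrite (sum_agrees_diff _ (fun p q => DeltaV (monoV (f (circle_at al a))) (p, q) *
      (eps (monoV p * wprod w (circle_set al' a)) * eps (monoV q * wprod w
        (circle_set al' b))))) ?ab' //.
    rewrite eps_Delta_sum (state_eval_split f a b) ab mulrC; congr (_ * _).
    rewrite /circle_eval color_at (_ : circle_set al a = circle_set al' a :|: circle_set al' b).
      by rewrite wprod_setU ?ab'.
    by rewrite [LHS](eq_class_of _ E) class_of_join //; exact: conn_eqv.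
- have E := merging_change h (conn_eqv al') ab.
  have ab' : conn al' a b by rewrite E join_relE //; exact: conn_eqv.
  rewrite ab' (sum_agrees_same _ (fun p => coefV (monoV (f (circle_at al a)) * monoV (f
    (circle_at al b))) p * eps (monoV p * wprod w (circle_set al' a)))) //.
  rewrite eps_mulV_sum (_ : circle_set al' a = circle_set al a :|: circle_set al b); last first.
    by rewrite [LHS](eq_class_of _ E) class_of_join //; exact: conn_eqv.
  rewrite wprod_setU ?ab // /comul_at.
  have Kp p : state_eval f (mul_at (mul_at w a (dualV p)) b (monoV p)) =
      circle_eval f (mul_at (mul_at w a (dualV p)) b (monoV p)) (circle_set al a) *
      circle_eval f (mul_at (mul_at w a (dualV p)) b (monoV p)) (circle_set al b) * K.
    by rewrite (state_eval_split f a b) ab KE //; [left | right].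
  rewrite (eq_bigr _ (fun p _ => Kp p)) -big_distrl mulrC; congr (_ * _) => /=.
  transitivity (\sum_p eps (monoV (f (circle_at al a)) * wprod w (circle_set al a)
    * dualV p) * eps (monoV p * (monoV (f (circle_at al b)) * wprod w (circle_set al b)))).
    by rewrite eps_dualV_sum mulrACA.
  have ba : conn al b a = false by have [_ rs _] := conn_eqv al; rewrite rs ab.
  apply: eq_bigr => p _; rewrite /circle_eval !wprod_mul_at !mem_circle_set !rr ab ba !mulr1.
  by rewrite !color_at -[monoV p * _ in LHS]mulrC -!mulrA.
Qed.

End EdgeMap.

End Adjunction.

(** * The differential squares to zero *)

Section SquareZero.
Variables (n : nat) (n_gt0 : (0 < n)%N) (G : tpmgraph).
Local Notation R := (Zinv n).
Local Notation X := (strand_half G).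
Local Notation W := {ffun X -> V n}.
Local Notation state_eval := (state_eval n_gt0).
Local Notation chain_eval := (chain_eval n_gt0).
Implicit Types (al : state G) (i j : 'I_(ell G)) (w : W) (v : chain n G).

Lemma smoothing_op_sum (I : finType) (r r' : rel X) a b (c : I -> R) (F : I -> W -> R) w :
  smoothing_op r r' a b (fun w => \sum_k c k * F k w) w =
  \sum_k c k * smoothing_op r r' a b (F k) w.
Proof.
rewrite /smoothing_op; case: ifP => _; first by case: ifP.
rewrite /comul_at.
by rewrite exchange_big /=; apply: eq_bigr => k _; rewrite mulr_sumr.
Qed.

Lemma eq_smoothing_op (F' F : W -> R) (r r' : rel X) a b w : F =1 F' ->
  smoothing_op r r' a b F w = smoothing_op r r' a b F' w.
Proof.
move=> E; rewrite /smoothing_op !E; case: ifP => // _.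
by apply: eq_bigr => p _; rewrite E.
Qed.

Definition clear al i : state G := set_state al i false.

Lemma set_clear al i : al i -> set_state (clear al i) i true = al.
Proof. by move=> ai; apply/ffunP => j; rewrite !ffunE; case: eqP => // ->. Qed.

Lemma clear_eq al al' i :
  (~~ al i && (al' == set_state al i true)) = (al' i && (al == clear al' i)).
Proof.
apply/andP/andP => [[/negbTE ai /eqP ->]|[ai /eqP ->]].
  rewrite !ffunE eqxx; split=> //; apply/eqP/ffunP => j; rewrite !ffunE.
  by case: eqP => // ->.
by rewrite !ffunE eqxx set_clear.
Qed.

Definition boundary_op al i : (W -> R) -> W -> R :=
  smoothing_op (conn (clear al i)) (conn al) (UL i) (UR i).

(** Adjunction turns the sum over source generators into one over the entries 1 of [al']: each of
    them, once cleared, gives the state the term comes from. *)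
Lemma chain_eval_differential v al' w :
  chain_eval (differential v) al' w =
  \sum_(i | al' i) (-1) ^+ sign_count (clear al' i) i *
    boundary_op al' i (chain_eval v (clear al' i)) w.
Proof.
rewrite /chain_eval.
transitivity (\sum_(i : 'I_(ell G)) \sum_(al : state G | ~~ al i && (al' == set_state al i true))
  (-1) ^+ sign_count al i * smoothing_op (conn al) (conn al') (UL i) (UR i) (chain_eval v al) w).
  transitivity (\sum_(f' : {ffun circle al' ->
    mono n}) \sum_(al : state G) \sum_(f : {ffun circle al -> mono n})
     \sum_(i : 'I_(ell G) | ~~ al i && (al' == set_state al i true))
       (-1) ^+ sign_count al i * edge_coef i (existT _ al f) (existT _ al' f') * v
         (existT _ al f) * state_eval f' w).
    apply: eq_bigr => f' _; rewrite ffunE big_distrl /=.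
    rewrite sig_big_dep /=; apply: eq_bigr => -[al f] _ /=.
    by rewrite big_distrl.
  rewrite exchange_big [RHS](exchange_big_dep xpredT) //=; apply: eq_bigr => al _.
  under eq_bigr => f' _ do rewrite exchange_big /=.
  rewrite exchange_big /=; apply: eq_bigr => i /andP [/negbTE ai /eqP al'E].
  rewrite smoothing_op_sum mulr_sumr exchange_big /=; apply: eq_bigr => f _.
  subst al'; rewrite -(edge_map_adjoint n_gt0 ai) !mulr_sumr; apply: eq_bigr => f' _.
  by move: (edge_coef _ _ _) => e; rewrite -!mulrA [X in _ * X = _]mulrCA.
rewrite [RHS]big_mkcond; apply: eq_bigr => i _.
under eq_bigl => al do rewrite clear_eq.
by case: (al' i); rewrite ?big_pred1_eq // big_pred0.
Qed.

Lemma chain_eval_tensor_form v al : tensor_form (conn al) (chain_eval v al).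
Proof.
have T f := state_eval_tensor_form n_gt0 (al := al) f.
split=> [w x y u xy|w x u u'|w x c u].
- by apply: eq_bigr => f _; have [E _ _] := T f; rewrite (E w _ _ _ xy).
- by rewrite -big_split; apply: eq_bigr => f _; have [_ E _] := T f; rewrite E mulrDr.
- by rewrite mulr_sumr; apply: eq_bigr => f _; have [_ _ E] := T f; rewrite E mulrCA.
Qed.

Lemma boundary_op_comm v al i j w : al i -> al j -> i != j ->
  boundary_op al j (boundary_op (clear al j) i (chain_eval v (clear (clear al j) i))) w =
  boundary_op al i (boundary_op (clear al i) j (chain_eval v (clear (clear al i) j))) w.
Proof.
move=> ai aj ij; have E : clear (clear al i) j = clear (clear al j) i by exact: set_stateC.
have ji : j != i by rewrite eq_sym.
have ch al1 k : al1 k -> smoothing_change (conn (clear al1 k)) (conn al1) (UL k) (UR k).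
  move=> ak; rewrite -{2}(set_clear ak); apply: smoothing_changeP.
  by rewrite !ffunE eqxx.
rewrite /boundary_op E.
apply: (face_commute n_gt0 w); rewrite ?E; try exact: conn_eqv.
- by apply: ch; rewrite !ffunE (negbTE ij).
- exact: ch.
- by rewrite -E; apply: ch; rewrite !ffunE (negbTE ji).
- exact: ch.
- exact: chain_eval_tensor_form.
Qed.

Lemma antisym_sum (N : nat) (U : zmodType) (P : pred 'I_N) (F : 'I_N -> 'I_N -> U) :
  (forall i j : 'I_N, P i -> P j -> (i < j)%N -> F j i = - F i j) ->
  \sum_(j | P j) \sum_(i | P i && (i != j)) F j i = 0.
Proof.
move=> FN.
transitivity (\sum_(j | P j) (\sum_(i | P i && (i < j)%N) F j i + \sum_(i | P i &&
  (j < i)%N) F j i)).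
  apply: eq_bigr => j _; rewrite (bigID (fun i : 'I_N => (i < j)%N)) /=.
  congr (_ + _); apply: eq_bigl => i; rewrite -andbA; congr (_ && _); rewrite -val_eqE /=;
  case: ltngtP => //.
rewrite big_split /= [X in _ + X](exchange_big_dep P) /=; last by move=> j i _ /andP [].
rewrite -big_split big1 //= => j Pj; apply/eqP; rewrite addr_eq0 -sumrN; apply/eqP.
rewrite [RHS](eq_bigl (fun k : 'I_N => P k && (k < j)%N)) => [|k]; last by rewrite Pj.
by apply: eq_bigr => i /andP [Pi ij]; rewrite FN.
Qed.

Lemma differentialK v : differential (differential v) = 0.
Proof.
apply: (@chain_eval_eq0 _ n_gt0) => al w; rewrite chain_eval_differential.
pose s al i : R := (-1) ^+ sign_count al i.
transitivity (\sum_(j | al j) \sum_(i | al i && (i != j))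
  s (clear al j) j * s (clear (clear al j) i) i *
  boundary_op al j (boundary_op (clear al j) i (chain_eval v (clear (clear al j) i))) w).
  apply: eq_bigr => j aj.
  rewrite /boundary_op (eq_smoothing_op _ _ _ _ _ (chain_eval_differential v (clear al j))).
  rewrite (@eq_smoothing_op (fun w => \sum_i (if clear al j i then (-1) ^+ sign_count
    (clear (clear al j) i) i else 0) *
     boundary_op (clear al j) i (chain_eval v (clear (clear al j) i)) w)); last first.
    by move=> w'; rewrite big_mkcond; apply: eq_bigr => i _; case: ifP => //; rewrite mul0r.
  rewrite smoothing_op_sum mulr_sumr [RHS]big_mkcond; apply: eq_bigr => i _.
  rewrite ffunE; case: (i == j) => /=; first by rewrite andbF mul0r mulr0.
  by rewrite andbT; case: (al i); rewrite ?mul0r ?mulr0 // mulrA.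
apply: antisym_sum => i j ai aj ij.
have nij : i != j by rewrite -val_eqE /= neq_ltn ij.
rewrite boundary_op_comm // -mulNr; congr (_ * _).
have sc al1 k : sign_count (clear al1 k) k = sign_count al1 k.
  apply: eq_card => l; rewrite !inE ffunE; case: eqP => // ->; by rewrite ltnn.
rewrite /s !sc.
have -> : sign_count (clear al j) i = sign_count al i.
  apply: eq_card => l; rewrite !inE ffunE; case: eqP => // ->; by rewrite ltnNge (ltnW ij).
(* As i < j, clearing entry i removes one entry 1 to the left of j, while clearing j does not affect
   the count at i: the two orders have opposite signs. *)
have -> : sign_count al j = (sign_count (clear al i) j).+1.
  rewrite /sign_count (cardsD1 i) !inE ij ai; congr (_.+1); apply: eq_card => l.
  by rewrite !inE !ffunE; case: (eqVneq l i) => //=; rewrite andbF.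
by rewrite exprS -mulrA mulN1r mulrC.
Qed.

End SquareZero.

(** * Grading *)

Lemma degree_arith n a b c d e i j k : (i < n)%N ->
  (2 * a + b = 2 * (c + e) + d)%N -> b = d %[mod 2] -> (2 * e + d + 2 * i + j = k + 2 * n)%N ->
  d + j = k %[mod 2] ->
  (2 * a + b + (2 * i + j) = 2 * c + k + 2 * n)%N /\ (b + j = k %[mod 2]).
Proof. by move=> lin e1 e2 e3 e4; split; lia. Qed.

Section Degrees.
Variables (n : nat) (n_gt0 : (0 < n)%N).
Local Notation R := (Zinv n).

Definition xdeg (p : mono n) : nat := (2 * p.1 + p.2)%N.
Definition ydeg (p : mono n) : nat := p.2.

Definition same_degree (a b c d : nat) := (a = c %[mod n]) /\ (b = d %[mod gpar n]).

Lemma modgpar a b : ~~ odd n -> a = b %[mod 2] -> a = b %[mod gpar n].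
Proof. by rewrite /gpar => /negbTE ->. Qed.

Lemma modgpar_odd a b : odd n -> a = b %[mod gpar n].
Proof. by rewrite /gpar => ->; rewrite !modn1. Qed.

Lemma gpar_mod2 a b : a = b %[mod 2] -> a = b %[mod gpar n].
Proof.
by case: (boolP (odd n)) => [o _|e]; [exact: modgpar_odd | exact: modgpar].
Qed.

Lemma coefV_mul_degree (p q r : mono n) : coefV (monoV p * monoV q) r != 0 ->
  same_degree (xdeg p + xdeg q) (ydeg p + ydeg q) (xdeg r) (ydeg r).
Proof.
rewrite /monoV mulrACA -!exprD => /(coefV_xy n_gt0) [e1 e2].
rewrite /xdeg /ydeg; split; last by apply: gpar_mod2; rewrite e2.
by rewrite e1; congr (_ %% n)%N; lia.
Qed.

(** [theta] has integer degree n, which vanishes modulo n, and for even n it contains y to the even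
    power 2. *)
Lemma coefV_mV_degree (p q : mono n) : coefV (mV (monoV p)) q != 0 ->
  same_degree (xdeg p) (ydeg p) (xdeg q) (ydeg q).
Proof.
rewrite mVE /theta /monoV; case: (boolP (odd n)) => on.
  rewrite -[X in _ * (_ * X)]expr1 mulrACA -!exprD => /(coefV_xy n_gt0) [e1 e2].
  split; last exact: modgpar_odd.
  rewrite /xdeg e1 -[LHS]modnDr; congr (_ %% n)%N; lia.
rewrite mulrACA -!exprD => /(coefV_xy n_gt0) [e1 e2]; split.
  rewrite /xdeg e1 -[LHS]modnDr; congr (_ %% n)%N; lia.
by apply: modgpar => //; rewrite /ydeg e2 modnDr.
Qed.

(** [dualV r] is homogeneous of degree 2n minus that of [r], with the same parity in y; so Delta
    raises the integer degree by 2n. *)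
Lemma coefV_Delta_degree (p q r : mono n) : DeltaV (monoV p) (q, r) != 0 ->
  same_degree (xdeg p) (ydeg p) (xdeg q + xdeg r) (ydeg q + ydeg r).
Proof.
rewrite (DeltaVE n_gt0) mulrAC eps_dualV /dualV mulrCA coefV_iota => nz.
have {nz} nz : coefV (monoV p * match val r.2 with
  | 0 => xV n ^+ (n.-1 - r.1) * yV n ^+ 2 - xV n ^+ (n - r.1)
  | 1 => xV n ^+ (n.-1 - r.1) * yV n
  | _ => xV n ^+ (n.-1 - r.1) end) q != 0.
  by apply: contra_neq nz => ->; rewrite mulr0.
suff [e1 e2] : (xdeg q + xdeg r = xdeg p + 2 * n)%N /\ (ydeg q + ydeg r = ydeg p %[mod 2]).
  by split; [rewrite e1 addnC modnMDl | apply/esym/gpar_mod2].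
have := ltn_ord r.1; case: r nz => [i [[|[|[|//]]]]] /= j3; rewrite /xdeg /ydeg /=.
- rewrite mulrBr coefVD coefVN => nz lin.
  have : (coefV (monoV p * (xV n ^+ (n.-1 - i) * yV n ^+ 2)) q != 0) ||
         (coefV (monoV p * (xV n ^+ (n - i))) q != 0).
    by rewrite -negb_and; apply: contra nz => /andP [/eqP -> /eqP ->]; rewrite subrr.
  rewrite /monoV mulrACA (mulrAC (xV n ^+ p.1) (yV n ^+ p.2) (xV n ^+ (n - i))) -!exprD.
  case/orP => /(coefV_xy n_gt0) [e1 e2]; apply: (degree_arith lin e1 e2); move: lin; clear;
    by move: (nat_of_ord i) (nat_of_ord p.2) => u v; lia.
- rewrite -[X in _ * (_ * X)]expr1 /monoV mulrACA -!exprD => /(coefV_xy n_gt0) [e1 e2] lin.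
  apply: (degree_arith lin e1 e2); move: lin; clear;
    by move: (nat_of_ord i) (nat_of_ord p.2) => u v; lia.
- rewrite /monoV mulrAC -exprD => /(coefV_xy n_gt0) [e1 e2] lin.
  apply: (degree_arith lin e1 e2); move: lin; clear;
    by move: (nat_of_ord i) (nat_of_ord p.2) => u v; lia.
Qed.

Lemma sum_circles (G : tpmgraph) (al : state G) (f : {ffun circle al ->
  mono n}) (d : mono n -> nat) :
  (\sum_c d (f c) = \sum_(C in circles al) d (color n_gt0 f C))%N.
Proof. by rewrite [RHS]big_sub; apply: eq_bigr => c _; rewrite color_val. Qed.

Lemma sum_circles_split (G : tpmgraph) (al : state G) (f : {ffun circle al ->
  mono n}) (d : mono n -> nat) a b :
  (\sum_c d (f c) = (if conn al a b then d (f (circle_at al a)) else d (f (circle_at al a))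
    + d (f (circle_at al b)))
    + \sum_(C in other_classes (conn al) a b) d (color n_gt0 f C))%N.
Proof.
have [rr _ _] := conn_eqv al.
have bO : class_of (conn al) b \notin other_classes (conn al) a b by rewrite !inE rr !andbF.
have aO : class_of (conn al) a \notin other_classes (conn al) a b by rewrite !inE rr !andbF.
rewrite sum_circles -!(color_at n_gt0); move: (color n_gt0 f) => {f} col.
rewrite circlesE (classes_split a b (conn_eqv al)).
case: ifP => ab.
  have /eqP <- : class_of (conn al) a == class_of (conn al) b by rewrite (class_of_eq _ _
    (conn_eqv al)).
  by rewrite setUA setUid big_setU1.
rewrite big_setU1 /=; last first.
  by rewrite in_setU1 (negbTE aO) (class_of_eq _ _ (conn_eqv al)) ab.
by rewrite big_setU1 //= addnA.
Qed.

Lemma has_gradeE (G : tpmgraph) (al : state G) (f : {ffun circle al -> mono n}) (g : grade n) :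
  has_grade (existT _ al f : gen n G) g =
  ((\sum_c xdeg (f c)) %% n == g.1)%N && ((\sum_c ydeg (f c)) %% gpar n == g.2)%N.
Proof. by []. Qed.

Lemma edge_coef_grade (G : tpmgraph) (i : 'I_(ell G)) (s s' : gen n G) (g : grade n) :
  ~~ tag s i && (tag s' == set_state (tag s) i true) ->
  edge_coef i s s' != 0 -> has_grade s g = has_grade s' g.
Proof.
case: s s' => [al f] [al' f'] /= /andP [/negbTE ai /eqP E]; subst al'.
rewrite /edge_coef /= (unaffectedE n_gt0 ai).
case fa: (agrees _ _ _ _ f'); last by rewrite mulr0n mul0r eqxx.
rewrite mulr1n mul1r !circle_at_eq => nz.
set a := UL i in nz fa *; set b := UR i in nz fa *; pose al' := set_state al i true.
rewrite -?/al' in f' nz fa *.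
have others d : (\sum_(C in other_classes (conn al') a b) d (color n_gt0 f' C) =
    \sum_(C in other_classes (conn al) a b) d (color n_gt0 f C))%N.
  rewrite other_circles //; apply: eq_bigr => C; rewrite -(other_circles ai) => CU.
  by move/forall_inP: fa => /(_ C CU) /eqP ->.
have h := smoothing_changeP ai; rewrite -/(conn al) -/al' -/(conn al') -/a -/b in h.
pose part al1 (f1 : {ffun circle al1 -> mono n}) (d : mono n -> nat) :=
  (if conn al1 a b then d (f1 (circle_at al1 a)) else d (f1 (circle_at al1 a)) + d (f1
    (circle_at al1 b)))%N.
have [e1 e2] : same_degree (part al f xdeg) (part al f ydeg) (part al' f' xdeg) (part al' f' ydeg).
  move: nz; rewrite /part; case ab: (conn al a b).
    case: (conn al' a b); [exact: coefV_mV_degree | exact: coefV_Delta_degree].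
  have -> : conn al' a b by rewrite (merging_change h (conn_eqv al') ab) join_relE //;
    exact: conn_eqv.
  exact: coefV_mul_degree.
rewrite !has_gradeE !(sum_circles_split _ _ a b) -/al' !others.
rewrite -/(part al f xdeg) -/(part al' f' xdeg) -/(part al f ydeg) -/(part al' f' ydeg).
by congr (_ && _); congr (_ == _); rewrite -modnDml ?e1 ?e2 modnDml.
Qed.

End Degrees.

(** * Ranks *)

Lemma clear_denominators m p (M : 'M[rat]_(m, p)) :
  exists2 c : int, c != 0 & exists M' : 'M[int]_(m, p), c%:~R *: M = map_mx intr M'.
Proof.
pose c := \prod_(ij : 'I_m * 'I_p) denq (M ij.1 ij.2).
exists c; first by apply/prodf_neq0 => ij _; exact: denq_neq0.
exists (\matrix_(i, j) (numq (M i j) * \prod_(ij | ij != (i, j)) denq (M ij.1 ij.2))).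
apply/matrixP => i j; rewrite !mxE /c (bigD1 (i, j)) //= !rmorphM /=.
by rewrite numqE mulrC mulrA [M i j * _]mulrC.
Qed.

Section Rank.
Variables (n : nat) (n_gt0 : (0 < n)%N) (G : tpmgraph).
Local Notation R := (Zinv n).
Local Notation N := #|gen n G|.
Implicit Types (v : chain n G) (g : grade n) (j : nat).

(** Chains are viewed over the field of rationals, where matrix ranks are available; the
    differential acts by multiplication on the right. *)
Definition row_of v : 'rV[rat]_N := \row_k Zinv_val (v (enum_val k)).

Definition differential_coef (s s' : gen n G) : R :=
  \sum_(i | ~~ tag s i && (tag s' == set_state (tag s) i true))
     (-1) ^+ sign_count (tag s) i * edge_coef i s s'.

Definition differential_mx : 'M[rat]_N :=
  \matrix_(k, l) Zinv_val (differential_coef (enum_val k) (enum_val l)).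

Definition degree_mx j g : 'M[rat]_N :=
  diag_mx (\row_k ((weight (tag (enum_val k)) == j) && has_grade (enum_val k) g)%:R).

Lemma Zinv_val_sum (I : finType) (F : I -> R) : Zinv_val (\sum_k F k) = \sum_k Zinv_val (F k).
Proof. exact: (raddf_sum (val : R -> rat)). Qed.

Lemma Zinv_valM (a b : R) : Zinv_val (a * b) = Zinv_val a * Zinv_val b.
Proof. exact: (rmorphM (val : R -> rat)). Qed.

Lemma Zinv_val_int (c : int) : Zinv_val (c%:~R : R) = c%:~R.
Proof. exact: (rmorph_int (val : R -> rat)). Qed.

Lemma row_of_inj : injective row_of.
Proof.
move=> u v uv; apply/ffunP => s; apply: val_inj.
by have /rowP /(_ (enum_rank s)) := uv; rewrite !mxE enum_rankK.
Qed.

Lemma row_of0 : row_of 0 = 0.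
Proof. by apply/rowP => k; rewrite !mxE ffunE. Qed.

Lemma row_ofZ a v : row_of (a *: v) = Zinv_val a *: row_of v.
Proof. by apply/rowP => k; rewrite !mxE ffunE -Zinv_valM. Qed.

Lemma row_of_comb r (a : 'I_r -> R) (z : 'I_r -> chain n G) :
  row_of (\sum_k a k *: z k) = \row_k Zinv_val (a k) *m \matrix_(k < r) row_of (z k).
Proof.
apply/rowP => l; rewrite !mxE sum_ffunE Zinv_val_sum.
by apply: eq_bigr => k _; rewrite ffunE !mxE -Zinv_valM.
Qed.

Lemma row_of_differential v : row_of (differential v) = row_of v *m differential_mx.
Proof.
apply/rowP => l; rewrite !mxE ffunE Zinv_val_sum.
rewrite (reindex_onto enum_val enum_rank) /=; last by move=> s _; rewrite enum_rankK.
rewrite (eq_bigl xpredT) => [|k]; last by rewrite enum_valK eqxx.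
apply: eq_bigr => k _; rewrite !mxE -Zinv_valM mulrC /differential_coef mulr_suml.
by [].
Qed.

Definition chain_of (r : 'rV[int]_N) : chain n G := [ffun s => (r 0 (enum_rank s))%:~R].

Lemma row_of_chain_of r : row_of (chain_of r) = map_mx intr r.
Proof. by apply/rowP => k; rewrite !mxE ffunE enum_valK Zinv_val_int. Qed.

Lemma in_chainP j g v : reflect (in_chain j g v) (row_of v <= degree_mx j g)%MS.
Proof.
apply: (iffP idP) => [/submxP [u E] s vs|vjg].
  have /rowP /(_ (enum_rank s)) := E; rewrite mul_mx_diag !mxE enum_rankK.
  case: andP => [[/eqP -> ->] //|_]; rewrite mulr0 => vs0.
  by case/eqP: vs; apply: val_inj.
suff -> : row_of v = row_of v *m degree_mx j g by exact: submxMl.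
rewrite mul_mx_diag; apply/rowP => k; rewrite !mxE.
case: (eqVneq (v (enum_val k)) 0) => [->|/vjg [-> ->]]; first by rewrite mul0r.
by rewrite eqxx mulr1.
Qed.

Definition cycle_mx j g := (degree_mx j g :&: kermx differential_mx)%MS.

Lemma is_cycleP j g v : reflect (is_cycle j g v) (row_of v <= cycle_mx j g)%MS.
Proof.
rewrite sub_capmx; apply: (iffP andP) => -[/in_chainP vjg].
  by move/sub_kermxP; rewrite -row_of_differential -row_of0 => /row_of_inj.
by move=> dv; split=> //; apply/sub_kermxP; rewrite -row_of_differential dv row_of0.
Qed.

Definition boundary_mx j g : 'M[rat]_N :=
  if j is j'.+1 then degree_mx j' g *m differential_mx else 0.

Lemma is_boundary_sub j g v : is_boundary j g v -> (row_of v <= boundary_mx j g)%MS.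
Proof.
case: j => [->|j [u /in_chainP uj ->]] /=; first by rewrite row_of0 sub0mx.
by rewrite row_of_differential submxMr.
Qed.

(** A rational preimage need not have coefficients in R; only a nonzero integer multiple of it is
    certain to. *)
Lemma sub_is_boundary j g v : (row_of v <= boundary_mx j g)%MS ->
  exists2 c : int, c != 0 & is_boundary j g (c%:~R *: v).
Proof.
case: j => [|j] /=.
  by rewrite submx0 -row_of0 => /eqP /row_of_inj ->; exists 1; rewrite ?scaler0.
case/submxP => u E; have [c c0 [u' uE]] := clear_denominators (u *m degree_mx j g).
exists c => //; exists (chain_of u').
  by apply/in_chainP; rewrite row_of_chain_of -uE scalemx_sub ?submxMl.
apply: row_of_inj; rewrite row_ofZ Zinv_val_int E mulmxA scalemxAl uE -row_of_chain_of.
by rewrite row_of_differential.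
Qed.

Lemma independent_classesP j g r : independent_classes G j g r <->
  exists2 z : 'I_r -> chain n G, forall k, (row_of (z k) <= cycle_mx j g)%MS &
  forall a : 'rV[rat]_r, (a *m \matrix_(k < r) row_of (z k) <= boundary_mx j g)%MS -> a = 0.
Proof.
split=> [[z [zc zi]]|[z zc zi]]; exists z.
- by move=> k; apply/is_cycleP.
- move=> a; have [c c0 [a' aE]] := clear_denominators a => aB.
  have : (row_of (\sum_k (a' 0 k)%:~R *: z k)%R <= boundary_mx j g)%MS.
    rewrite row_of_comb (_ : \row_k _ = c%:~R *: a); first by rewrite -scalemxAl scalemx_sub.
    by rewrite aE; apply/rowP => k; rewrite !mxE Zinv_val_int.
  case/sub_is_boundary => c' c'0; rewrite scaler_sumr.
  under eq_bigr do rewrite scalerA.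
  move=> /zi a0; apply: (scalerI (_ : c%:~R != 0 :> rat)); first by rewrite intr_eq0.
  rewrite aE scaler0; apply/rowP => k; rewrite !mxE.
  have /(congr1 (@Zinv_val n)) := a0 k.
  rewrite Zinv_valM !Zinv_val_int => /eqP; rewrite mulf_eq0 intr_eq0 (negbTE c'0) /=.
  by move/eqP.
- split=> [k|a aB]; first by apply/is_cycleP.
  have := zi (\row_k Zinv_val (a k)); rewrite -row_of_comb.
  move/(_ (is_boundary_sub aB)) => /rowP E k; apply: val_inj.
  by have := E k; rewrite !mxE.
Qed.

(** Independent classes stay independent in the cokernel of the boundaries, which bounds their
    number above; a basis of a complement of the boundaries in the cycles attains the bound. *)
Lemma MH_rankE j g : (boundary_mx j g <= cycle_mx j g)%MS ->
  MH_rank G j g = (\rank (cycle_mx j g) - \rank (boundary_mx j g))%N.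
Proof.
set Z := cycle_mx j g; set B := boundary_mx j g => BZ.
have rankZB : \rank (Z *m cokermx B) = (\rank Z - \rank B)%N.
  have := mxrank_mul_ker Z (cokermx B).
  have -> : \rank (Z :&: kermx (cokermx B))%MS = \rank B.
    apply: eqmx_rank; apply/andP; split.
      by rewrite submxE; apply/eqP/sub_kermxP; exact: capmxSr.
    by rewrite sub_capmx BZ; apply/sub_kermxP; exact: mulmx_coker.
  by move=> <-; rewrite addnK.
apply/eqP; rewrite eqn_leq; apply/andP; split.
  apply/bigmax_leqP => r /asboolP /independent_classesP [z zc zi].
  set M := \matrix_(k < r) row_of (z k) in zi.
  have MZ : (M <= Z)%MS by apply/row_subP => k; rewrite rowK.
  suff /eqP <- : row_free (M *m cokermx B) by rewrite -rankZB mxrankS // submxMr.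
  rewrite -kermx_eq0; apply/eqP/row_matrixP => k; rewrite row0; apply: zi.
  by rewrite submxE -mulmxA -row_mul mulmx_ker row0.
move r0_def: (_ - _)%N => r0.
have r0E : \rank (Z :\: B)%MS = r0.
  have := mxrank_cap_compl Z B; rewrite -[RHS](subnKC (mxrankS BZ)) r0_def.
  have -> : \rank (Z :&: B)%MS = \rank B.
    by apply: eqmx_rank; rewrite capmxSr sub_capmx BZ submx_refl.
  by move/addnI.
rewrite -{}r0E {r0_def r0 rankZB}.
have r0N : (\rank (Z :\: B)%MS < N.+1)%N by rewrite ltnS rank_leq_col.
rewrite -[\rank _]/(val (Ordinal r0N)).
apply: (leq_bigmax_cond (P := fun r : 'I_N.+1 =>
  `[< independent_classes G j g r >]) (F := fun r => val r)).
apply/asboolP/independent_classesP.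
(* Scaling the rational basis by one nonzero integer gives chains over R and keeps the span. *)
have [c c0 [M' M'E]] := clear_denominators (row_base (Z :\: B)%MS).
have zE : \matrix_(k < _) row_of (chain_of (row k M')) = c%:~R *: row_base (Z :\: B)%MS.
  by rewrite M'E; apply/row_matrixP => k; rewrite rowK row_of_chain_of map_row.
exists (fun k => chain_of (row k M')) => [k|a] /=.
  have <- : row k (c%:~R *: row_base (Z :\: B)%MS) = row_of (chain_of
    (row k M')) by rewrite -zE rowK.
  apply: submx_trans (row_sub _ _) _; apply: scalemx_sub.
  by rewrite eq_row_base diffmxSl.
rewrite zE => aB; have : (a *m (c%:~R *: row_base (Z :\: B)%MS) <= (Z :\: B) :&: B)%MS.
  rewrite sub_capmx aB andbT; apply: submx_trans (submxMl _ _) _.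
  by apply: scalemx_sub; rewrite eq_row_base.
rewrite capmx_diff submx0 -scalemxAr scaler_eq0 intr_eq0 (negbTE c0) /= => /eqP a0.
by apply: (row_free_inj (row_base_free (Z :\: B)%MS)); rewrite a0 mul0mx.
Qed.

(** The matrix factors as E^T E, where [E] selects the coordinates in [b] and E E^T is the identity
    of size [#|b|]. *)
Lemma rank_indicator_mx m (b : pred 'I_m) :
  \rank (diag_mx (\row_k (b k)%:R) : 'M[rat]_m) = #|b|.
Proof.
pose E : 'M[rat]_(#|b|, m) := \matrix_(i, k) (enum_val i == k)%:R.
have EET : E *m E^T = 1%:M.
  apply/matrixP => i j; rewrite !mxE (bigD1 (enum_val i)) //= !mxE eqxx mul1r.
  rewrite big1 ?addr0; first by rewrite (inj_eq enum_val_inj) eq_sym.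
  by move=> k ki; rewrite !mxE eq_sym (negbTE ki) mul0r.
have EP : E *m diag_mx (\row_k (b k)%:R) = E.
  rewrite mul_mx_diag; apply/matrixP => i k; rewrite !mxE.
  case: eqP => [<-|_]; last by rewrite mul0r.
  by have := enum_valP i; rewrite -topredE /= => ->; rewrite mulr1.
have ETE : E^T *m E = diag_mx (\row_k (b k)%:R).
  apply/matrixP => k l; rewrite !mxE; case: (boolP (b k)) => bk.
    rewrite (bigD1 (enum_rank_in bk k)) //= !mxE enum_rankK_in // eqxx mul1r.
    rewrite big1 ?addr0 // => i ik; rewrite !mxE; case: eqP => [e|_]; last by rewrite mul0r.
    by case/eqP: ik; apply: enum_val_inj; rewrite enum_rankK_in.
  rewrite mul0rn big1 // => i _; rewrite !mxE; case: eqP => [e|_]; last by rewrite mul0r.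
  by have := enum_valP i; rewrite e -topredE /= (negbTE bk).
have <- : \rank E = #|b|.
  by apply/eqP; rewrite -/(row_free E); apply/row_freeP; exists E^T.
by apply: eqmx_rank; rewrite -{1}ETE submxMl -{1}EP submxMl.
Qed.

Definition gens_of_degree j g := [set s : gen n G | (weight (tag s) == j) && has_grade s g].

Lemma rank_degree_mx j g : \rank (degree_mx j g) = #|gens_of_degree j g|.
Proof.
rewrite rank_indicator_mx -(card_image enum_val_inj).
apply: eq_card => s; rewrite inE; apply/imageP/idP => [[k kS ->] //|sS].
by exists (enum_rank s); rewrite ?enum_rankK // -topredE /= enum_rankK.
Qed.

Lemma weight_set_state (al : state G) i : ~~ al i ->
  weight (set_state al i true) = (weight al).+1.
Proof.
move=> /negbTE ai; rewrite /weight (bigD1 i) //= [in RHS](bigD1 i) //= ffunE eqxx ai.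
by congr (_.+1); apply: eq_bigr => j /negbTE ji; rewrite ffunE ji.
Qed.

Lemma differential_coef_neq0 s s' : differential_coef s s' != 0 ->
  exists2 i, ~~ tag s i && (tag s' == set_state (tag s) i true) & edge_coef i s s' != 0.
Proof.
move=> nz; suff /existsP [i /andP [si ei]] :
  [exists i, (~~ tag s i && (tag s' == set_state (tag s) i true)) &&
    (edge_coef i s s' != 0)] by exists i.
apply: contraNT nz; rewrite negb_exists => /forallP H; apply/eqP/big1 => i si.
by have := H i; rewrite si /= negbK => /eqP ->; rewrite mulr0.
Qed.

Lemma differential_mxK : differential_mx *m differential_mx = 0.
Proof.
apply/row_matrixP => k; rewrite row_mul rowE row0.
have -> : delta_mx 0 k = row_of (chain_of (delta_mx 0 k)).
  by rewrite row_of_chain_of map_delta_mx.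
by rewrite -!row_of_differential differentialK // row_of0.
Qed.

Lemma boundary_sub_cycle j g : (boundary_mx j g <= cycle_mx j g)%MS.
Proof.
case: j => [|j] /=; first exact: sub0mx.
rewrite sub_capmx; apply/andP; split; last first.
  by apply/sub_kermxP; rewrite -mulmxA differential_mxK mulmx0.
(* The differential raises the weight by one and keeps the grade, so projecting its image to that
   degree changes nothing. *)
suff {1}-> : degree_mx j g *m differential_mx
  = degree_mx j g *m differential_mx *m degree_mx j.+1 g.
  exact: submxMl.
rewrite mul_mx_diag; apply/matrixP => k l; rewrite mul_diag_mx !mxE.
case: andP => [[/eqP wk gk]|_]; last by rewrite !mul0r.
rewrite !mul1r; case: (eqVneq (differential_coef (enum_val k) (enum_val l)) 0) => [->|nz].
  by rewrite mul0r.
have [i si ei] := differential_coef_neq0 nz.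
have -> : has_grade (enum_val l) g by rewrite -(edge_coef_grade n_gt0 g si ei).
by case/andP: si => ai /eqP ->; rewrite weight_set_state // wk eqxx mulr1.
Qed.

(** Rank-nullity for the differential on one graded piece, in additive form to avoid truncated
    subtraction. *)
Lemma MH_rank_count j g :
  (MH_rank G j g + \rank (boundary_mx j g) + \rank (boundary_mx j.+1 g) = #|gens_of_degree j g|)%N.
Proof.
rewrite MH_rankE ?boundary_sub_cycle // subnK ?mxrankS ?boundary_sub_cycle //.
by rewrite addnC -rank_degree_mx /cycle_mx mxrank_mul_ker.
Qed.

Lemma weight_le (al : state G) : (weight al < (ell G).+1)%N.
Proof.
rewrite ltnS; apply: (@leq_trans (\sum_(i < ell G) 1)); last by rewrite sum1_card card_ord.
by apply: leq_sum => i _; exact: leq_b1.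
Qed.

Lemma boundary_mx_ell g : \rank (boundary_mx (ell G).+1 g) = 0%N.
Proof.
apply/eqP; rewrite mxrank_eq0 /=; apply/eqP/matrixP => k l; rewrite mul_diag_mx !mxE.
case: andP => [[/eqP wk _]|_]; last by rewrite mul0r.
case: (eqVneq (differential_coef (enum_val k) (enum_val l)) 0) => [->|nz].
  by rewrite mulr0.
have [i /andP [ai _] _] := differential_coef_neq0 nz.
have := weight_le (set_state (tag (enum_val k)) i true).
by rewrite weight_set_state // wk ltnS ltnn.
Qed.

End Rank.

(** * The state sum *)

Section RootOfUnitySums.
Variables (A : comPzRingType) (n : nat) (q : A).
Hypothesis qn : q ^+ n = 1.

Lemma exp_mod k : q ^+ (k %% n) = q ^+ k.
Proof. by rewrite {2}(divn_eq k n) exprD mulnC exprM qn expr1n mul1r. Qed.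

Lemma sum_even_odd (F : nat -> A) m :
  \sum_(k < m.*2) F k = \sum_(k < m) F k.*2 + \sum_(k < m) F k.*2.+1.
Proof.
elim: m => [|m IH]; first by rewrite !big_ord0 addr0.
by rewrite doubleS !big_ord_recr /= IH -!addrA; congr (_ + _); rewrite addrCA.
Qed.

Lemma sum_shift (F : nat -> A) : F n = F 0%N -> \sum_(k < n) F k.+1 = \sum_(k < n) F k.
Proof.
move=> Fn; apply/(addrI (F 0%N)).
by rewrite -(big_ord_recl n F) [LHS]big_ord_recr /= Fn addrC.
Qed.

Lemma sum_pow_shift2 c : \sum_(i < n) q ^+ (2 * i + (c + 2)) = \sum_(i < n) q ^+ (2 * i + c).
Proof.
rewrite -(sum_shift (F := fun i => q ^+ (2 * i + c))).
  by apply: eq_bigr => i _; congr (_ ^+ _); lia.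
by rewrite muln0 add0n exprD mulnC exprM qn expr1n mul1r.
Qed.

(** For even n, doubling on Z/n is two-to-one onto the even residues. *)
Lemma sum_pow_double_even : ~~ odd n ->
  \sum_(i < n) q ^+ (2 * i) = \sum_(k < n./2) 2%:R * q ^+ k.*2.
Proof.
move=> /even_halfK e; transitivity (\sum_(i < n./2 + n./2) q ^+ (2 * i)).
  by rewrite addnn e.
rewrite big_split_ord /=.
rewrite -big_split /=; apply: eq_bigr => i _.
rewrite mulr_natl mulr2n; congr (_ + _); first by congr (_ ^+ _); lia.
by rewrite mulnDr [(2 * n./2)%N]mul2n e exprD qn mul1r; congr (_ ^+ _); lia.
Qed.

(** For odd n, doubling permutes Z/n: the first (n+1)/2 values are the even residues, the others the
    odd ones. *)
Lemma sum_pow_double_odd : odd n ->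
  \sum_(i < n) q ^+ (2 * i) = \sum_(k < n) q ^+ k.
Proof.
move=> on; have e : n = (n./2.*2.+1) by rewrite -[in LHS](odd_double_half n) on.
have -> : \sum_(k < n) q ^+ k = \sum_(k < n./2.+1) q ^+ k.*2 + \sum_(k < n./2) q ^+ k.*2.+1.
  transitivity (\sum_(k < n./2.*2.+1) q ^+ k); first by rewrite -e.
  by rewrite big_ord_recr /= sum_even_odd big_ord_recr /= addrAC.
transitivity (\sum_(i < n./2.+1 + n./2) q ^+ (2 * i)).
  by rewrite (_ : n./2.+1 + n./2 = n)%N //; lia.
rewrite big_split_ord /=; congr (_ + _); apply: eq_bigr => i _; first by congr (_ ^+ _); lia.
have -> : (2 * (n./2.+1 + i) = n + i.*2.+1)%N by lia.
by rewrite exprD qn mul1r.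
Qed.

End RootOfUnitySums.

Section CircleValue.
Variables (n : nat) (n_gt0 : (0 < n)%N).

Lemma Xnsub1_monic (A : comNzRingType) m : (0 < m)%N ->
  'X^m - 1 \is @monic A /\ size ('X^m - 1 : {poly A}) = m.+1.
Proof. by move=> m0; rewrite -[1%R]/(1%:P) monicXnsubC // size_XnsubC. Qed.

Lemma Xnsub1_quotient (A : comNzRingType) m : (0 < m)%N ->
  ('qX ^+ m : {poly %/ ('X^m - 1 : {poly A})}) = 1.
Proof.
move=> m0; have [mo sE] := Xnsub1_monic A m0.
have sz : (1 < size ('X^m - 1 : {poly A})%R)%N by rewrite sE.
apply/eqP; rewrite -subr_eq0; apply/eqP; rewrite -[RHS](in_qpoly_self sz mo).
by rewrite rmorphB rmorphXn rmorph1.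
Qed.

Lemma qvarXn : qvar n ^+ n = 1.
Proof. by rewrite -rmorphXn Xnsub1_quotient // rmorph1. Qed.

Lemma gpar_gt0 : (0 < gpar n)%N. Proof. by rewrite /gpar; case: ifP. Qed.

Lemma bvarXgpar : bvar n ^+ gpar n = 1.
Proof. exact: (Xnsub1_quotient (Zq n) gpar_gt0). Qed.

Definition mono_value (p : mono n) : Zqb n := qvar n ^+ xdeg p * bvar n ^+ ydeg p.

(** The value of a circle is the graded dimension of V. The powers 1, y, y^2 contribute the factors
    1, qb, q^2, and q^2 is absorbed by a shift of the exponent of x. *)
Lemma circle_valueE : circle_value n = \sum_p mono_value p.
Proof.
have q0 := qvarXn; rewrite big_mono /circle_value /mono_value /xdeg /ydeg /=.
have T0 : \sum_(i < n) qvar n ^+ (2 * i + 0) = \sum_(i < n) qvar n ^+ (2 * i).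
  by apply: eq_bigr => i _; rewrite addn0.
have T2 : \sum_(i < n) qvar n ^+ (2 * i + 2) = \sum_(i < n) qvar n ^+ (2 * i).
  by rewrite -T0 -(sum_pow_shift2 q0 0).
have T1 : \sum_(i < n) qvar n ^+ (2 * i + 1) = qvar n * \sum_(i < n) qvar n ^+ (2 * i).
  by rewrite mulr_sumr; apply: eq_bigr => i _; rewrite addn1 exprS.
rewrite !big_split -!mulr_suml T0 T1 T2 /= expr0 mulr1 expr1.
case: (boolP (odd n)) => on.
  have -> : bvar n = 1 by have := bvarXgpar; rewrite /gpar on expr1.
  rewrite expr1n !mulr1 sum_pow_double_odd //.
  have -> : qvar n * \sum_(k < n) qvar n ^+ k = \sum_(k < n) qvar n ^+ k.
    rewrite -[RHS](sum_shift (F := fun k => qvar n ^+ k)) ?q0 // mulr_sumr.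
    by apply: eq_bigr => k _; rewrite exprS.
  by rewrite mulr_natl 2!mulrS mulr1n addrA.
have -> : bvar n ^+ 2 = 1 by have := bvarXgpar; rewrite /gpar (negbTE on).
rewrite mulr1 sum_pow_double_even //.
have -> : qvar n * (\sum_(k < n./2) 2 * qvar n ^+ k.*2) * bvar n =
    2 * \sum_(k < n./2) qvar n ^+ k.*2.+1 * bvar n.
  rewrite !mulr_sumr mulr_suml; apply: eq_bigr => k _.
  by rewrite mulrCA exprS !mulrA.
rewrite -!mulr_suml; move: (\sum_(k < n./2) 2 * _) (_ * bvar n) => u v.
by rewrite addrAC mulrDr [2 * u]mulr_natl mulr2n.
Qed.

End CircleValue.

Section StateSum.
Variables (n : nat) (n_gt0 : (0 < n)%N) (G : tpmgraph).

Lemma skein_sum (s : seq 'I_(ell G)) (al : state G) : uniq s ->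
  skein n s al = \sum_(be : state G | [forall j, (j \notin s) ==> (be j == al j)])
     (-1) ^+ (\sum_(j <- s) be j)%N * circle_value n ^+ #|circles be|.
Proof.
elim: s al => [|i s IH] al /=.
  move=> _; rewrite (big_pred1 al) => [|be]; first by rewrite big_nil expr0 mul1r.
  apply/forallP/eqP => [H|-> j]; last by rewrite eqxx.
  by apply/ffunP => j; apply/eqP; have := H j.
case/andP => si us; rewrite !IH // [RHS](bigID (fun be : state G => be i)) /= [RHS]addrC.
have cond b (be : state G) : [forall j, (j \notin s) ==> (be j == set_state al i b j)] =
    [forall j, (j \notin i :: s) ==> (be j == al j)] && (be i == b).
  apply/forallP/andP => [H|[/forallP H /eqP bi] j].
    split; last by have := H i; rewrite si ffunE eqxx.
    apply/forallP => j; rewrite inE negb_or; apply/implyP => /andP [ji js].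
    by have := H j; rewrite js ffunE (negbTE ji).
  apply/implyP => js; rewrite ffunE; case: (eqVneq j i) => [->|ji]; first by rewrite bi.
  by have := H j; rewrite inE negb_or ji js.
congr (_ + _).
  apply: eq_big => [be|be bP]; first by rewrite cond; case: (be i).
  by move: bP; rewrite cond => /andP [_ /eqP bi]; rewrite big_cons bi.
rewrite -sumrN; apply: eq_big => [be|be bP]; first by rewrite cond; case: (be i).
move: bP; rewrite cond => /andP [_ /eqP bi]; rewrite big_cons bi.
by rewrite exprS mulN1r mulNr.
Qed.

Lemma bracket_state_sum :
  bracket n G = \sum_(al : state G) (-1) ^+ weight al * circle_value n ^+ #|circles al|.
Proof.
rewrite /bracket skein_sum ?enum_uniq //; apply: eq_big => [be|be _].
  by apply/forallP => j; rewrite mem_enum.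
by rewrite /weight big_enum.
Qed.

Definition gen_value (s : gen n G) : Zqb n := \prod_c mono_value (tagged s c).

Lemma sum_gen_value :
  \sum_(s : gen n G) (-1) ^+ weight (tag s) * gen_value s = bracket n G.
Proof.
rewrite bracket_state_sum.
rewrite -(sig_big_dep (fun _ => true) (fun _ _ => true)
  (fun al (f : {ffun circle al -> mono n}) => (-1) ^+ weight al * \prod_c mono_value (f c))) /=.
apply: eq_bigr => al _; rewrite -mulr_sumr; congr (_ * _).
rewrite circle_valueE // -(bigA_distr_bigA (fun (c : circle al) p => mono_value p)) /=.
by rewrite prodr_const card_sig.
Qed.

Lemma gen_value_grade (s : gen n G) (g : grade n) : has_grade s g ->
  gen_value s = qvar n ^+ g.1 * bvar n ^+ g.2.
Proof.
case: s => al f; rewrite has_gradeE => /andP [/eqP <- /eqP <-].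
rewrite (exp_mod (qvarXn n_gt0)) (exp_mod (bvarXgpar n)).
by rewrite /gen_value /mono_value big_split /= !prodrXr.
Qed.

Lemma telescope_alternating (A : pzRingType) (b : nat -> nat) m :
  \sum_(i < m) (b i + b i.+1)%:R * (-1) ^+ i = (b 0%N)%:R - (b m)%:R * (-1) ^+ m :> A.
Proof.
elim: m => [|m IH]; first by rewrite big_ord0 expr0 mulr1 subrr.
by rewrite big_ord_recr IH /= natrD mulrDl addrA subrK exprS mulN1r mulrN opprK.
Qed.

Definition grade_of (s : gen n G) : grade n :=
  (Ordinal (ltn_pmod (\sum_c (2 * (tagged s c).1 + (tagged s c).2)) n_gt0),
   Ordinal (ltn_pmod (\sum_c (tagged s c).2) (gpar_gt0 n))).

Lemma has_grade_of s g : has_grade s g = (grade_of s == g).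
Proof. by case: g. Qed.

Lemma Mh_eval : (Mh n G).[-1] = bracket n G.
Proof.
rewrite /Mh horner_poly -sum_gen_value /qdim_MH.
under eq_bigr => i _ do rewrite mulr_suml.
rewrite exchange_big (partition_big grade_of xpredT) //=; apply: eq_bigr => g _.
rewrite (partition_big (fun s => Ordinal (weight_le (tag s))) xpredT) //=.
pose mon := qvar n ^+ g.1 * bvar n ^+ g.2.
pose b i := \rank (boundary_mx G i g).
have b0 : b 0%N = 0%N by rewrite /b /= mxrank0.
have bl : b (ell G).+1 = 0%N by exact: boundary_mx_ell.
transitivity (mon * \sum_(i < (ell G).+1) #|gens_of_degree G i g|%:R * (-1) ^+ i).
  (* Each boundary rank is counted in two adjacent degrees and cancels; at both ends it is 0. *)
  have := telescope_alternating (Zqb n) b (ell G).+1.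
  rewrite b0 bl mul0r subrr => T.
  under [X in _ = mon * X]eq_bigr => i _ do
    rewrite -(MH_rank_count n_gt0 G i g) -addnA natrD mulrDl.
  rewrite big_split /= T addr0 mulr_sumr; apply: eq_bigr => i _.
  by rewrite -/mon mulrAC mulrC mulrA.
rewrite mulr_sumr; apply: eq_bigr => i _.
rewrite (eq_bigr (fun=> (-1) ^+ i * mon)) => [|s /andP [/eqP sg /eqP <-]]; last first.
  by rewrite (gen_value_grade (g := g)) // has_grade_of sg.
rewrite sumr_const mulrC -[RHS]mulr_natl mulrA; congr (_%:R * _ * _).
by apply: eq_card => s; rewrite [LHS]inE has_grade_of andbC.
Qed.

End StateSum.

(** * Graphs with a loop at every matching edge *)

Section Looped.
Variables (n : nat) (n_gt0 : (0 < n)%N) (G : tpmgraph).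
Hypothesis looped : forall i : 'I_(ell G), opp (rot (medge i)) = rot (rot (medge i)).
Hypothesis ell_gt0 : (0 < ell G)%N.
Local Notation R := (Zinv n).

Lemma looped_conn (al : state G) i : conn al (UL i) (UR i).
Proof.
have [_ cs _] := conn_eqv al; rewrite cs; apply: connect1.
by rewrite /strand /= looped eqxx.
Qed.

(** The loop puts UL and UR on one circle in every state, so neither a merge nor a split can
    occur. *)
Lemma looped_circles (al : state G) i :
  circles (set_state al i false) = circles (set_state al i true).
Proof.
have a0 : set_state al i false i = false by rewrite ffunE eqxx.
have := nonmerging_change (smoothing_changeP a0) (looped_conn _ i).
rewrite -/(conn _) looped_conn => /eq_classes; rewrite !circlesE => <-.
by congr (classes (conn _)); apply/ffunP => j; rewrite !ffunE; case: eqP.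
Qed.

Lemma looped_skein s (al : state G) i :
  skein n s (set_state al i false) = skein n s (set_state al i true).
Proof.
elim: s al => [|j s IH] al /=; first by rewrite looped_circles.
have [->|ji] := eqVneq j i.
  have E b c : set_state (set_state al i b) i c = set_state al i c.
    by apply/ffunP => k; rewrite !ffunE; case: eqP.
  by rewrite !E.
by rewrite !(set_stateC _ _ _ (_ : i != j)) 1?eq_sym // !IH.
Qed.

Lemma looped_bracket : bracket n G = 0.
Proof.
rewrite /bracket (@skeinE n G _ _ (Ordinal ell_gt0)) ?mem_enum //.
by rewrite looped_skein subrr.
Qed.

Definition unit_mono : mono n := (Ordinal n_gt0, ord0).

Definition unit_gen : gen n G :=
  existT _ ([ffun=> true] : state G) [ffun=> unit_mono].

(** The integer degree 2i + j is preserved by reduction in V, and [theta] has a factor y, so degree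
    0 is never reached. *)
Lemma coefV_mV_unit p : coefV (mV (monoV p)) unit_mono = 0.
Proof.
apply/eqP; apply/negPn/negP; rewrite mVE /theta /monoV.
case: ifP => _; last by rewrite mulrACA -!exprD => /(coefV_xy n_gt0) [] /=; lia.
by rewrite -[X in _ * (_ * X)]expr1 mulrACA -!exprD => /(coefV_xy n_gt0) [] /=; lia.
Qed.

Lemma differential_coef_unit (s : gen n G) : differential_coef s unit_gen = 0.
Proof.
apply/eqP/negPn/negP => /differential_coef_neq0 [i _].
by rewrite /edge_coef /= !circle_at_eq !looped_conn ffunE coefV_mV_unit mulr0 eqxx.
Qed.

Lemma differential_coef_unit_left (s : gen n G) : differential_coef unit_gen s = 0.
Proof.
by apply/eqP/negPn/negP => /differential_coef_neq0 [i]; rewrite ffunE.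
Qed.

Lemma differentialE (v : chain n G) s' : differential v s' = \sum_s differential_coef s s' * v s.
Proof. by rewrite ffunE; apply: eq_bigr => s _; rewrite mulr_suml. Qed.

Lemma is_boundary_differential j (g : grade n) (v : chain n G) : (0 < j)%N ->
  is_boundary j g v -> exists u, v = differential u.
Proof. by case: j => // j _ [u _ ->]; exists u. Qed.

Lemma looped_MH_rank : (0 < MH_rank G (ell G) (grade_of n_gt0 unit_gen))%N.
Proof.
have r1 : (1 < #|gen n G|.+1)%N by rewrite ltnS; apply/card_gt0P; exists unit_gen.
apply: (leq_trans _ (leq_bigmax_cond (P := fun r : 'I__.+1 =>
  `[< independent_classes G (ell G) _ r >]) (F := fun r => val r) (Ordinal r1) _)) => //.
apply/asboolP; exists (fun _ => [ffun s => (s == unit_gen)%:R]); split.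
  move=> _; split.
    move=> s; rewrite ffunE; case: (eqVneq s unit_gen) => [-> _|_]; last by rewrite eqxx.
    split; last by rewrite has_grade_of.
    rewrite /weight /= (eq_bigr (fun=> 1%N)) ?sum1_card ?card_ord // => i _.
    by rewrite ffunE.
  apply/ffunP => s'; rewrite differentialE ffunE big1 // => s _; rewrite ffunE.
  case: (eqVneq s unit_gen) => [->|_]; last by rewrite mulr0.
  by rewrite differential_coef_unit_left mul0r.
move=> a; rewrite /= big_ord1 => bd k; rewrite (ord1 k).
have [u /ffunP /(_ unit_gen)] := is_boundary_differential ell_gt0 bd.
rewrite differentialE big1 => [|s _]; last by rewrite differential_coef_unit mul0r.
by rewrite !ffunE eqxx /= => <-; rewrite -[LHS]mulr1.
Qed.

(** Evaluation of the remainders at q = b = 1. It sends the graded dimension to the total rank, so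
    one positive rank makes the dimension nonzero. *)
Definition augmentation (u : Zqb n) : int := ((u : {poly Zq n}).[1] : {poly int}).[1].

Lemma augmentationD u v : augmentation (u + v) = augmentation u + augmentation v.
Proof.
rewrite /augmentation.
have -> : (u + v : {poly Zq n}).[1] = (u : {poly Zq n}).[1] + (v : {poly Zq n}).[1] :=
  hornerD _ _ _.
exact: hornerD.
Qed.

Lemma augmentation0 : augmentation 0 = 0.
Proof. by apply: (addrI (augmentation 0)); rewrite -augmentationD !addr0. Qed.

Lemma augmentation_monomial (a b : nat) : (a < n)%N -> (b < gpar n)%N ->
  augmentation (qvar n ^+ a * bvar n ^+ b) = 1.
Proof.
move=> an bg; rewrite /augmentation -rmorphXn.
have [qm qs] := Xnsub1_monic int n_gt0; have [bm bs] := Xnsub1_monic (Zq n) (gpar_gt0 n).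
have -> : (qpolyC _ ('qX ^+ a) * bvar n ^+ b : {poly Zq n}) = 'qX ^+ a *: 'X^b.
  by rewrite [LHS]qpolyC_mulE qXn_small ?bs ?ltnS ?gpar_gt0.
rewrite hornerZ hornerXn expr1n mulr1.
have -> : ('qX ^+ a : {poly %/ ('X^n - 1 : {poly int})}) = 'X^a :> {poly int}.
  by rewrite qXn_small ?qs.
by rewrite hornerXn expr1n.
Qed.

Lemma looped_qdim_neq0 : qdim_MH n G (ell G) != 0.
Proof.
apply/eqP => /(congr1 augmentation); rewrite augmentation0 /qdim_MH.
rewrite (big_morph augmentation augmentationD augmentation0).
have E k a b : (a < n)%N -> (b < gpar n)%N ->
    augmentation (k%:R * (qvar n ^+ a * bvar n ^+ b)) = k%:R.
  move=> an bg; elim: k => [|k IH]; first by rewrite mul0r augmentation0.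
  by rewrite -!natr1 mulrDl mul1r augmentationD IH augmentation_monomial.
under eq_bigr => g _ do rewrite E //.
rewrite -natr_sum => /eqP; rewrite pnatr_eq0 sum_nat_eq0 =>
  /forallP /(_ (grade_of n_gt0 unit_gen)) /=.
by rewrite eqn0Ngt looped_MH_rank.
Qed.

End Looped.

(* Cubic graph with vertex set W * bool and matching edges {(w, false), (w, true)}:
   the half-edge 0 at each vertex is matched, and the half-edge 1 at v is joined
   to the half-edge 2 at [tw v]. *)
Section TwistGraph.
Variables (W : finType) (tw : W * bool -> W * bool).
Hypotheses (twK : involutive tw) (W_gt0 : (0 < #|W|)%N).
Let mate (v : W * bool) : W * bool := (v.1, ~~ v.2).
Hypothesis tw_connected : forall u v : W * bool,
  connect [rel x y | (y == mate x) || (y == tw x)] u v.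
Hypothesis tw_loop : forall w, tw (w, false) = (w, false).

Definition twist_half : finType := ((W * bool) * 'I_3)%type.
Implicit Types h k : twist_half.

Definition twist_rot_fun h : twist_half := (h.1, ordS h.2).
Lemma twist_rot_inj : injective twist_rot_fun.
Proof. by move=> [v k] [v' k'] [-> e]; congr (_, _); apply: ordS_inj; apply: val_inj. Qed.
Definition twist_rot : {perm twist_half} := perm twist_rot_inj.

Definition twist_opp h : twist_half :=
  match val h.2 with
  | 0 => (mate h.1, h.2)
  | 1 => (tw h.1, ord_max)
  | _ => (tw h.1, inord 1)
  end.

Lemma twist_oppK : involutive twist_opp.
Proof.
move=> [v [[|[|[|//]]] k3]]; rewrite /twist_opp /= ?inordK //= ?twK.
- by rewrite /mate /= negbK -surjective_pairing.
- by congr (_, _); apply: val_inj; rewrite /= inordK.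
- by congr (_, _); apply: val_inj.
Qed.

Lemma twist_opp_neq h : twist_opp h != h.
Proof.
case: h => [[w t] [[|[|[|//]]] k3]]; rewrite /twist_opp -pair_eqE /pair_eq /= -?val_eqE /=
  ?inordK // ?andbF //.
by rewrite /mate -pair_eqE /= -/(_ == _); case: t; rewrite !andbF.
Qed.

Lemma twist_porbitP h k : (k \in porbit twist_rot h) = (k.1 == h.1).
Proof.
apply/porbitP/eqP => [[m ->]|e].
  by rewrite permX; elim: m => //= m IH; rewrite permE /= IH.
(* The number of rotations from position i to position j is j - i modulo 3, kept nonnegative by
   adding 3. *)
case: h k e => v i [v' j] /= ->; exists (j + (3 - i))%N; rewrite permX.
have it m : iter m twist_rot (v, i) = (v, iter m (@ordS 3) i).
  by elim: m => //= m ->; rewrite permE.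
have vit m : (iter m (@ordS 3) i : nat) = ((i + m) %% 3)%N.
  elim: m => [|m IH] /=; first by rewrite addn0 modn_small.
  by rewrite IH; lia.
by rewrite it; congr (_, _); apply: ord_inj; rewrite vit; have := ltn_ord i; have := ltn_ord j; lia.
Qed.

Lemma twist_connected h k :
  connect (fun a b => (b == twist_rot a) || (b == twist_opp a)) h k.
Proof.
set e := (X in connect X).
have rot0 v i j : connect e (v, i) (v, j).
  have : (v, j) \in porbit twist_rot (v, i) by rewrite twist_porbitP.
  case/porbitP => m ->; elim: m => [|m IH]; first by rewrite perm1 connect0.
  apply: connect_trans IH _; apply: connect1; rewrite /e expgSr permM.
  by rewrite eqxx.
have step u v : [rel x y | (y == mate x) || (y == tw x)] u v -> forall i j, connect e (u, i) (v, j).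
  move=> /= /orP [] /eqP -> i j.
    apply: connect_trans (rot0 _ _ ord0) _; apply: connect_trans (rot0 _ ord0 _).
    by apply: connect1; rewrite /e /twist_opp /= eqxx orbT.
  apply: connect_trans (rot0 _ _ ord_max) _; apply: connect_trans (rot0 _ (inord 1) _).
  by apply: connect1; rewrite /e /twist_opp /= eqxx orbT.
case: h k => u i [v j].
have /connectP [p] := tw_connected u v.
elim: p u i => [|w p IH] u i /=; first by move=> _ ->; exact: rot0.
case/andP => uw pw vE; apply: connect_trans (step _ _ uw i ord0) _.
exact: IH.
Qed.

Lemma twist_half_gt0 : (0 < #|twist_half|)%N.
Proof. by rewrite !card_prod card_bool card_ord !muln_gt0 W_gt0. Qed.

Definition twist_ribbon : ribbon :=
  Ribbon twist_oppK twist_opp_neq twist_half_gt0 twist_connected.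

Definition twist_medge (i : 'I_#|W|) : half twist_ribbon := ((enum_val i, false), ord0).

Lemma twist_medge_inj i j : on_edge (twist_medge i) (twist_medge j) -> i = j.
Proof.
by move=> /orP [] /eqP [] /enum_val_inj ->.
Qed.

Lemma twist_medge_perfect (h : half twist_ribbon) :
  #|[set k in porbit rot h | [exists i, on_edge (twist_medge i) k]]| = 1%N.
Proof.
apply/eqP/cards1P; exists (h.1, ord0); apply/setP => -[[w t] j]; rewrite !inE twist_porbitP /=.
rewrite -pair_eqE /= [X in _ && X](_ : _ = (j == ord0)) //.
apply/existsP/eqP => [[i]|->].
  by rewrite /on_edge /= => /orP [] /eqP [_ _ ->].
exists (enum_rank w); rewrite /on_edge /twist_medge /= /twist_opp /= enum_rankK.
by case: t; rewrite eqxx ?orbT.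
Qed.

Definition twist_pmgraph : pmgraph := PMGraph twist_medge_inj twist_medge_perfect.

Lemma twist_trivalent : trivalent twist_pmgraph.
Proof.
move=> h; transitivity #|setX [set h.1] [set: 'I_3]|.
  by apply: eq_card => -[v j]; rewrite twist_porbitP !inE andbT.
by rewrite cardsX cards1 cardsT card_ord.
Qed.

Definition twist_tpmgraph : tpmgraph := TPMGraph twist_trivalent.

Lemma twist_looped (i : 'I_(ell twist_tpmgraph)) :
  opp (rot (medge i)) = rot (rot (medge i)) :> half twist_tpmgraph.
Proof.
rewrite /= !permE /twist_rot_fun /= /twist_opp /= tw_loop.
by congr (_, _); apply: val_inj.
Qed.

End TwistGraph.

(** * Two graphs with vanishing bracket *)

Lemma one_edge_connected (u v : unit * bool) :
  connect [rel x y | (y == (x.1, ~~ x.2)) || (y == id x)] u v.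
Proof.
case: u v => [[] t] [[] t']; have [->|/eqP N] := eqVneq t t'; first exact: connect0.
by apply: connect1 => /=; case: t t' N => -[].
Qed.

Lemma card_unit_gt0 : (0 < #|{: unit}|)%N. Proof. by rewrite card_unit. Qed.

(* Both vertices of the matching edge carry a loop. *)
Definition one_edge_graph : tpmgraph :=
  twist_tpmgraph (tw := id) (fun _ => erefl) card_unit_gt0 one_edge_connected.

Definition chain_twist (v : bool * bool) : bool * bool := if v.2 then (~~ v.1, v.2) else v.

Lemma chain_twistK : involutive chain_twist.
Proof. by move=> [[] []]. Qed.

Lemma chain_connected (u v : bool * bool) :
  connect [rel x y | (y == (x.1, ~~ x.2)) || (y == chain_twist x)] u v.
Proof.
set e := (X in connect X).
have A p t : connect e (p, t) (p, ~~ t) by apply: connect1; rewrite /e /= eqxx.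
have B p : connect e (p, true) (~~ p, true) by apply: connect1; rewrite /e /= eqxx orbT.
have C p t : connect e (p, t) (~~ p, true).
  by case: t; [exact: B | exact: connect_trans (A p false) (B p)].
have D p t t' : connect e (p, t) (p, t').
  by case: t t' => -[]; [exact: connect0 | exact: A p true | exact: A p false | exact: connect0].
case: u v => p t [p' t']; have [->|N] := eqVneq p p'; first exact: D.
apply: connect_trans (C p t) _; rewrite (_ : ~~ p = p'); first exact: D.
by case: p p' N => -[].
Qed.

Lemma card_bool_gt0 : (0 < #|{: bool}|)%N. Proof. by rewrite card_bool. Qed.

(* Two matching edges, joined by a double edge, with a loop at both ends. *)
Definition two_edge_graph : tpmgraph :=
  twist_tpmgraph chain_twistK card_bool_gt0 chain_connected.

Theorem proposition6p1p4 (n : nat) (n_gt0 : (0 < n)%N) :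
  (forall G : tpmgraph, (Mh n G).[-1] = bracket n G) /\
  (exists G G' : tpmgraph, bracket n G = bracket n G' /\ Mh n G <> Mh n G').
Proof.
split; first exact: Mh_eval.
have loop1 := @twist_looped unit id (fun _ =>
  erefl) card_unit_gt0 one_edge_connected (fun _ => erefl).
have loop2 := @twist_looped bool _ chain_twistK card_bool_gt0 chain_connected (fun _ => erefl).
exists one_edge_graph, two_edge_graph; split.
  by rewrite !looped_bracket // /= ?card_unit ?card_bool.
(* The coefficient of t^2 lies beyond the range for the graph with one matching edge and is the
   nonzero top term for the other. *)
move=> /polyP /(_ (ell two_edge_graph)) /eqP; rewrite !coef_poly ltnS leqnn.
have -> : (ell two_edge_graph <= ell one_edge_graph)%N = false by rewrite /= card_unit card_bool.
by rewrite eq_sym; apply/negP/looped_qdim_neq0 => //; rewrite /= card_bool.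
Qed.
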